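(* Let $w(s;\alpha)=\alpha e^{-\alpha s}$ (so $\dim(\Theta)=3$), with $\Theta\subset\mathbb R^3$ a relatively compact open set of parameters $\theta=(\eta,\vartheta,\alpha)$ satisfying $0<\underline\eta\le\eta\le\bar\eta<\infty$, $0<\underline\vartheta\le\vartheta\le\bar\vartheta<\infty$, $0<\underline\alpha\le\alpha\le\bar\alpha<\infty$. Assume that the marks come from a stationary ergodic process with $\mathbb E_{\phi^*}[|G(\mathbf X)|^4]<\infty$. Then, under $H_0:\psi=0$ and with $p=(\dim(\Theta)+1)\vee4=4$, $$\sup_{t\in\mathbb R_+}\sum_{i=0}^2\Big\|\sup_{\theta\in\Theta}\big|\partial_\theta^i\,\partial_\psi\lambda_g(t;\theta,\phi^*,0)\big|\Big\|_p<\infty.$$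
   Context: A probability space carries a stationary process $(\mathbf y_t)_{t\in\mathbb R}$ with values in a Borel set $\mathbb X\subset\mathbb R^d$ with marginal density $f(\cdot;\phi^* )$, from a family $f(\cdot;\phi)$, $\phi\in\Phi$, and a rate-$1$ Poisson process $\overline N$ on $\mathbb R^2$ independent of $\mathbf y$. $\mathbb E_\phi$ is expectation when $\mathbf X\sim f(\cdot;\phi)$. Under $H_0$ the event process $N$ on $[0,\infty)$ is the Hawkes process $N(dt)=\int\mathbf 1_{\{0\le u\le\lambda(t;\theta^* )\}}\overline N(dt\times du)$ with $\lambda(t;\theta)=\eta+\vartheta\int_{[0,t)}w(t-s;\alpha)N(ds)$, where $\theta^*=(\eta^*,\vartheta^*,\alpha^* )\in\Theta$ is the true parameter and $\vartheta^*<1$. $N_g$ is the random measure on $[0,\infty)\times\mathbb X$ with points $(t_i,\mathbf y_{t_i})$, $t_i$ the event times of $N$. The boost function is $g(\mathbf x;\phi,\psi)=h(\mathbf x;\psi)/\mathbb E_\phi[h(\mathbf X;\psi)]$, $\psi\in\Psi\subset\mathbb R^r$, $0\in\Psi$. Throughout $h$ satisfies: (i) $h(\mathbf x;0)\equiv1$; (ii) $\mathbb E_\phi[h(\mathbf X;\psi)]$ and $\mathbb E_\phi[\partial_\psi h(\mathbf X;\psi)]$ exist for all $\psi,\phi$ ($h$ having first and second derivatives in $\psi$); (iii) $\partial_\phi\mathbb E_\phi[h(\mathbf X;\psi)]$ vanishes at $(\phi^*,\psi=0)$; (iv) $\partial_\phi\mathbb E_\phi[\partial_\psi h(\mathbf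 X;\psi)]$ exists at $(\phi^*,\psi=0)$; (v) $\mathrm{cov}_\phi(H(\mathbf X))$ is finite and positive definite for all $\phi$, where $H(\mathbf x)=\partial_\psi h(\mathbf x;0)$. Put $G(\mathbf x)=\partial_\psi g(\mathbf x;\phi^*,0)=H(\mathbf x)-\mathbb E_{\phi^*}[H(\mathbf X)]$. With $\lambda_g(t;\theta,\phi,\psi)=\eta+\vartheta\int_{[0,t)\times\mathbb X}w(t-s;\alpha)g(\mathbf x;\phi,\psi)N_g(ds\times d\mathbf x)$, $$\partial_\psi\lambda_g(t;\theta,\phi^*,0)=\vartheta\int_{[0,t)\times\mathbb X}w(t-s;\alpha)\,G(\mathbf x)\,N_g(ds\times d\mathbf x).$$ $\|\cdot\|_p$ is the $L^p(\mathbb P)$ norm.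
   Formalization: The mark process is additionally assumed jointly measurable in time and outcome for the sigma-algebra it generates (true for continuous or càdlàg paths); otherwise its value at an event time could be altered arbitrarily while it stays independent of the Poisson process, and the bound fails. *)

(* Defs.v *)
From HB Require Import structures.
From mathcomp Require Import all_boot all_order all_algebra.
From mathcomp Require Import all_classical all_reals all_analysis.
From mathcomp Require Import measurable_realfun.

Set Implicit Arguments.
Unset Strict Implicit.
Unset Printing Implicit Defensive.

Import Order.TTheory GRing.Theory Num.Theory.
Import numFieldNormedType.Exports.

Local Open Scope classical_set_scope.
Local Open Scope ring_scope.

Section cons_measure.
Context d (T : measurableType d) (R : realType).

Definition tcons n (z : T * n.-tuple T) : n.+1.-tuple T :=
  [tuple of z.1 :: z.2].

Lemma measurable_tcons n : measurable_fun [set: T * n.-tuple T] (@tcons n).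
Proof. exact: measurable_cons. Qed.

(* In the library the [SigmaFiniteMeasure] instance of a product of
   sigma-finite measures is shadowed by a later one for subprobabilities, hence
   this explicit lemma. *)
Lemma sigma_finite_prod d2 (T2 : measurableType d2)
    (m1 : {sigma_finite_measure set T -> \bar R})
    (m2 : {sigma_finite_measure set T2 -> \bar R}) :
  sigma_finite setT (m1 \x m2)%E.
Proof.
have /sigma_finiteP[F [TF ndF Foo]] := sigma_finiteT m1.
have /sigma_finiteP[G [TG ndG Goo]] := sigma_finiteT m2.
exists (fun k => F k `*` G k).
  rewrite -setXTT TF TG predeqE => -[x y]; split; last first.
    by move=> [k _ []/= ? ?]; split; exists k.
  move=> [/= [i _ Fix] [j _ Gjy]]; exists (maxn i j) => //; split.
  - by move: x Fix; exact/subsetPset/ndF/leq_maxl.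
  - by move: y Gjy; exact/subsetPset/ndG/leq_maxr.
move=> k; have [mF Fk] := Foo k; have [mG Gk] := Goo k.
split; first exact: measurableX.
by rewrite product_measure1E// lte_mul_pinfty// ge0_fin_numE.
Qed.

Variables (mu : {sigma_finite_measure set T -> \bar R}).
Variables (n : nat) (m : {sigma_finite_measure set (n.-tuple T) -> \bar R}).

(* The image of [mu \x m] under [tcons]; iterating it yields the product
   measure on tuples. *)
Definition cons_measure : set (n.+1.-tuple T) -> \bar R :=
  fun A => (mu \x m)%E (@tcons n @^-1` A).

Let cons_measure_pushforward : {measure set (n.+1.-tuple T) -> \bar R} :=
  measure_function_pushforward__canonical__measure_function_Measure
    (mu \x m)%E (@measurable_tcons n).

HB.instance Definition _ := isMeasure.Build _ _ _ cons_measure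
  (@measure0 _ _ _ cons_measure_pushforward)
  (@measure_ge0 _ _ _ cons_measure_pushforward)
  (@measure_semi_sigma_additive _ _ _ cons_measure_pushforward).

Let cons_measure_sigma_finite : sigma_finite setT cons_measure.
Proof.
have [F TF Foo] := sigma_finite_prod mu m.
pose tl (v : n.+1.-tuple T) : T * n.-tuple T :=
  (tnth v ord0, [tuple of behead v]).
have mtl : measurable_fun setT tl.
  apply/measurable_fun_pair; first exact: measurable_tnth.
  exact: measurable_behead.
have tlK : cancel (@tcons n) tl.
  by move=> [x v]; congr pair => /=; apply/val_inj.
exists (fun k => tl @^-1` F k).
  by rewrite -preimage_bigcup -TF preimage_setT.
move=> k; have [mF Fk] := Foo k; split.
  by rewrite -[X in measurable X]setTI; exact: mtl.
rewrite /cons_measure -comp_preimage.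
by rewrite (_ : tl \o _ = id)//; apply/funext => z; exact: tlK.
Qed.

HB.instance Definition _ :=
  Measure_isSigmaFinite.Build _ _ _ cons_measure cons_measure_sigma_finite.
End cons_measure.

Fixpoint tuple_measure d (T : measurableType d) (R : realType)
    (mu : {sigma_finite_measure set T -> \bar R}) (n : nat) :
    {sigma_finite_measure set (n.-tuple T) -> \bar R} :=
  match n with
  | 0 => \d_([tuple] : 0.-tuple T)
  | k.+1 => cons_measure mu (tuple_measure mu k)
  end.

Definition lebesgue_tuple (R : realType) (n : nat) :
    {sigma_finite_measure set (n.-tuple (measurableTypeR R)) -> \bar R} :=
  tuple_measure (@lebesgue_measure R) n.

Section partial_derivatives.
Context {R : realType}.

Definition unitv n (j : 'I_n) : 'rV[R]_n := delta_mx 0 j.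

Definition grad n (F : 'rV[R]_n -> R) (x : 'rV[R]_n) : 'rV[R]_n :=
  \row_j 'D_(unitv j) F x.

Definition iter_partial n (V : normedModType R) (s : seq 'I_n)
    (F : 'rV[R]_n -> V) : 'rV[R]_n -> V :=
  foldr (fun j G => 'D_(unitv j) G) F s.

(* |d^i F (x)| in the sup norm on the array of all i-th order partial
   derivatives; `| _ | on row vectors is the sup norm as well. *)
Definition norm_partials n (V : normedModType R) (i : nat)
    (F : 'rV[R]_n -> V) (x : 'rV[R]_n) : R :=
  \big[Num.max/0]_(s : i.-tuple 'I_n) `|iter_partial s F x|.

End partial_derivatives.

Section processes.
Context {R : realType} {dO : measure_display} {Omega : measurableType dO}.
Variable P : probability Omega R.
Local Notation mR := (measurableTypeR R).

(* A random measure on [T] is a kernel from [Omega] to [T]. It is a point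
   process when it is integer-valued, and finite, on the measurable subsets of
   the windows [W m] (the bounded sets). *)
Definition point_process d (T : measurableType d) (W : nat -> set T)
    (M : R.-ker Omega ~> T) : Prop :=
  forall omega m B, measurable B -> B `<=` W m ->
    exists k : nat, M omega B = k%:R%:E.

Definition window1 (m : nat) : set mR := [set s : R | `|s| <= m%:R].

Definition window2 (m : nat) : set (mR * mR) :=
  [set z : R * R | `|z.1| <= m%:R /\ `|z.2| <= m%:R].

Definition lebesgue2 : set (mR * mR) -> \bar R :=
  (@lebesgue_measure R \x @lebesgue_measure R)%E.

(* Poisson process of rate 1 on the plane. The Poisson law is written out
   because [poisson_pmf 0] is not the mass function of the law at rate 0. *)
Definition poisson_process (M : R.-ker Omega ~> (mR * mR)%type) : Prop :=
  [/\ point_process window2 M,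
      (forall (B : set (mR * mR)) (k : nat),
        measurable B -> (lebesgue2 B < +oo)%E ->
        P [set omega | M omega B = k%:R%:E] =
        (expR (- fine (lebesgue2 B)) * fine (lebesgue2 B) ^+ k / k`!%:R)%:E) &
      (forall (n : nat) (B : 'I_n -> set (mR * mR)) (k : 'I_n -> nat),
        (forall i, measurable (B i)) -> trivIset setT B ->
        P (\bigcap_i [set omega | M omega (B i) = (k i)%:R%:E]) =
        (\prod_(i < n) P [set omega | M omega (B i) = (k i)%:R%:E])%E)].

Definition measure_events d (T : measurableType d) (M : R.-ker Omega ~> T) :
    set (set Omega) :=
  <<s [set E | exists (B : set T) (C : set (\bar R)),
           [/\ measurable B, measurable C &
           E = [set omega | C (M omega B)]]] >>.

Section path.
Context {dT : measure_display} {T : measurableType dT}.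

Definition cylinder_events : set (set (R -> T)) :=
  <<s [set C | exists (t : R) (A : set T),
         measurable A /\ C = [set x | A (x t)]] >>.

Variable y : R -> Omega -> T.

Definition path_events : set (set Omega) :=
  [set E | exists2 C, cylinder_events C & E = [set omega | C (y ^~ omega)]].

Definition stationary : Prop :=
  forall (s : R) (C : set (R -> T)), cylinder_events C ->
    P [set omega | C (fun t => y (t + s) omega)] =
    P [set omega | C (y ^~ omega)].

Definition ergodic : Prop :=
  forall C : set (R -> T), cylinder_events C ->
    (forall s : R, [set x | C (fun t => x (t + s))] = C) ->
    P [set omega | C (y ^~ omega)] = 0%E \/
    P [set omega | C (y ^~ omega)] = 1%E.

(* [y] is a measurable process: (t, omega) |-> y_t(omega) is jointly measurable,
   the sigma-algebra on [Omega] being the one generated by [y]. With the ambient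
   sigma-algebra instead, independence of [y] from another process would not
   control the value of [y] at the random times given by that process. *)
Definition measurable_process : Prop :=
  (forall t, measurable_fun setT (y t)) /\
  measurable_fun setT
    (fun z : (mR * g_sigma_algebraType path_events)%type => y z.1 z.2).

End path.

Definition independent_events (G1 G2 : set (set Omega)) : Prop :=
  forall A B, G1 A -> G2 B -> P (A `&` B) = (P A * P B)%E.

End processes.

Section hawkes.
Context {R : realType}.
Local Notation mR := (measurableTypeR R).
Implicit Types theta : 'rV[R]_3.

(* theta = (eta, vartheta, alpha) = (base_rate, branching, decay) *)
Definition base_rate theta : R := theta 0 (@Ordinal 3 0 isT).
Definition branching theta : R := theta 0 (@Ordinal 3 1 isT).
Definition decay theta : R := theta 0 (@Ordinal 3 2 isT).

Definition exp_kernel (s a : R) : R := a * expR (- a * s).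

Definition lambda (n : {measure set mR -> \bar R}) (t : R) theta : R :=
  base_rate theta
  + branching theta *
    (\int[n]_(s in `[0%R, t[) exp_kernel (t - s) (decay theta))%R.

(* [N] is required to be locally finite: the equation also admits explosive
   solutions. *)
Definition hawkes_process (dO : measure_display) (Omega : measurableType dO)
    (P : probability Omega R) (Nbar : R.-ker Omega ~> (mR * mR)%type)
    (N : R.-ker Omega ~> mR) theta : Prop :=
  point_process window1 N /\
  {ae P, forall omega, forall B : set mR, measurable B ->
     N omega B =
     (\int[Nbar omega]_(z in (B `&` [set s : R | (0 <= s)%R]) `*` setT)
        (\1_[set z : mR * mR | (0 <= z.2 <= lambda (N omega) z.1 theta)%R]
           z)%:E)%E}.

(* The random measure with points (t_i, y_{t_i}), t_i the points of [N]: the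
   image of [N omega] under t |-> (t, y_t(omega)). *)
Definition marked_measure (dO : measure_display) (Omega : measurableType dO)
    (dT : measure_display) (T : measurableType dT) (N : R.-ker Omega ~> mR)
    (y : R -> Omega -> T) (Ng : R.-ker Omega ~> (mR * T)%type) : Prop :=
  forall omega (A : set (mR * T)), measurable A ->
    Ng omega A = N omega [set s | A (s, y s omega)].

End hawkes.

Section boost.
Context {R : realType} {d q r : nat}.
Local Notation mR := (measurableTypeR R).
Local Notation mark := (d.-tuple mR).
Variables (X : set mark) (f : mark -> 'rV[R]_q -> R).
Variable (h : mark -> 'rV[R]_r -> R).
Implicit Types (phi : 'rV[R]_q) (psi : 'rV[R]_r) (k : mark -> R).

Definition density_family (Phi : set 'rV[R]_q) : Prop :=
  forall phi, Phi phi ->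
    [/\ measurable_fun X (f ^~ phi), (forall x, X x -> 0 <= f x phi) &
        (\int[lebesgue_tuple R d]_(x in X) (f x phi)%:E = 1)%E].

Definition expect phi k : R :=
  (\int[lebesgue_tuple R d]_(x in X) (k x * f x phi))%R.

Definition has_expect phi k : Prop :=
  (lebesgue_tuple R d).-integrable X (fun x => (k x * f x phi)%:E).

Definition boost (x : mark) phi psi : R := h x psi / expect phi (h ^~ psi).

Definition scoreH (x : mark) : 'rV[R]_r := grad (h x) 0.

Definition covH_entry phi (i j : 'I_r) (x : mark) : R :=
  (scoreH x 0 i - expect phi (fun x => scoreH x 0 i)) *
  (scoreH x 0 j - expect phi (fun x => scoreH x 0 j)).

Definition covH phi : 'M[R]_r :=
  \matrix_(i, j) expect phi (covH_entry phi i j).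

Definition scoreG phi (x : mark) : 'rV[R]_r :=
  scoreH x - \row_l expect phi (fun x => scoreH x 0 l).

(* Derivatives in psi and phi are those of the ambient spaces 'rV_r, 'rV_q. *)
Record boost_conditions (Phi : set 'rV[R]_q) (Psi : set 'rV[R]_r)
    (phi0 : 'rV[R]_q) : Prop := BoostConditions {
  h_measurable : forall psi, measurable_fun X (h ^~ psi);
  h_at0 : forall x, X x -> h x 0 = 1;
  h_derivable : forall x psi l, X x -> Psi psi -> derivable (h x) psi (unitv l);
  h_derivable2 : forall x psi l m, X x -> Psi psi ->
    derivable ('D_(unitv l) (h x)) psi (unitv m);
  h_expect : forall phi psi, Phi phi -> Psi psi -> has_expect phi (h ^~ psi);
  dh_expect : forall phi psi l, Phi phi -> Psi psi ->
    has_expect phi (fun x => 'D_(unitv l) (h x) psi);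
  dphi_expect_h : forall j,
    is_derive phi0 (unitv j) (fun phi => expect phi (h ^~ 0)) 0;
  dphi_expect_dh : forall j l,
    derivable (fun phi => expect phi (fun x => 'D_(unitv l) (h x) 0))
      phi0 (unitv j);
  covH_finite : forall phi i j, Phi phi -> has_expect phi (covH_entry phi i j);
  covH_posdef : forall phi (v : 'rV[R]_r), Phi phi -> v != 0 ->
    0 < (v *m covH phi *m v^T) 0 0;
  (* differentiation under the expectation: d_psi g(x; phi0, 0) = G(x) *)
  dpsi_g : forall x l, X x ->
    is_derive (0 : 'rV[R]_r) (unitv l) (boost x phi0) (scoreG phi0 x 0 l) }.

Definition lambda_g (ng : {measure set (mR * mark) -> \bar R}) (t : R)
    (theta : 'rV[R]_3) phi psi : R :=
  base_rate theta
  + branching theta *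
    (\int[ng]_(z in `[0%R, t[ `*` X)
       (exp_kernel (t - z.1) (decay theta) * boost z.2 phi psi))%R.

Definition dpsi_lambda_g (ng : {measure set (mR * mark) -> \bar R}) (t : R)
    (theta : 'rV[R]_3) phi psi : 'rV[R]_r :=
  grad (lambda_g ng t theta phi) psi.

Definition mark_process (dO : measure_display) (Omega : measurableType dO)
    (P : probability Omega R) (y : R -> Omega -> mark) phi : Prop :=
  [/\ measurable_process y, stationary P y, ergodic P y,
      (forall t omega, X (y t omega)) &
      (forall t (A : set mark), measurable A ->
         P (y t @^-1` A) =
         (\int[lebesgue_tuple R d]_(x in A `&` X) (f x phi)%:E)%E)].

End boost.

(* Main.v *)
(* Under H0 the score is a finite sum over the event times s < t of
   vartheta alpha exp (- alpha (t - s)) G(y_s), so its derivatives of order at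
   most 2 in theta are dominated, uniformly in theta, by
   Z_t = sum_s exp (- beta (t - s)) |G(y_s)| for any beta < alpha_lo, and it is
   enough to bound E[Z_t^4] uniformly in t.

   Cut [0, t + 1[ into J windows of length delta. As soon as delta is smaller
   than the gaps between events, each window contains at most one event time, and
   the events are dominated by the points of the Poisson process lying below
   levels that are constant on each window and depend only on the counts in the
   previous windows. Given the history of counts, each new count is a Poisson
   variable, directly by the independence of Poisson counts over disjoint sets.
   With s and x the discounted sums of the counts at rates beta and alpha*, the
   conditional expectation of exp (g s + K g x) over one window is absorbed by
   the decay of g as soon as beta <= alpha* (1 - vartheta* ) / 2, which bounds an
   exponential moment of s uniformly in J and t. Hoelder's inequality and the
   independence of the marks from the Poisson process bring the fourth moment of
   the marks out as a factor, and Fatou's lemma as J grows gives the bound for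
   Z_t. *)
Require Import Defs.
From HB Require Import structures.
From mathcomp Require Import all_boot all_order all_algebra.
From mathcomp Require Import all_classical all_reals all_analysis.
From mathcomp Require Import measurable_realfun.
From mathcomp Require Import ring lra.

Import Order.TTheory GRing.Theory Num.Theory.
Import numFieldNormedType.Exports.

Local Open Scope classical_set_scope.
Local Open Scope ring_scope.

Set Implicit Arguments.
Unset Strict Implicit.
Unset Printing Implicit Defensive.

(** * Integer-valued measures and finitely supported integrals *)

(** If no point of [D] carries mass, the masses of intervals shrinking to a point tend to 0 and,
    being integers, vanish for some radius. Every point then lies in a null cell with rational
    endpoints; such cells are countably many, so [mu D = 0]. *)
Lemma ex_atom (R : realType) (mu : {measure set (measurableTypeR R) -> \bar R})
    (D : set (measurableTypeR R)) : measurable D ->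
  (forall B, measurable B -> B `<=` D -> exists k : nat, mu B = k%:R%:E) ->
  mu D != 0%E -> exists2 s, D s & mu [set s] != 0%E.
Proof.
move=> mD muN; apply: contra_neqP => noatom.
pose cell (z : int) (n : nat) : set (measurableTypeR R) :=
  `[z%:~R / n.+1%:R, (z + 1)%:~R / n.+1%:R[%classic.
have mc z n : measurable (D `&` cell z n).
  by apply: measurableI => //; exact: measurable_itv.
pose G p := if (unpickle p : option (int * nat)) is Some (z, n) then
  (if mu (D `&` cell z n) == 0%E then D `&` cell z n else set0) else set0.
have GD : D = \bigcup_p G p.
  apply/seteqP; split=> [x Dx|x [p _]]; last first.
    by rewrite /G; case: unpickle => // -[z n]; case: ifP => // _ [].
  have Fx k : measurable (`[x - k.+1%:R^-1, x + k.+1%:R^-1]%classic :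
      set (measurableTypeR R)) by exact: measurable_itv.
  have capE : \bigcap_k (D `&` `[x - k.+1%:R^-1, x + k.+1%:R^-1]) = [set x].
    apply/seteqP; split=> [y Dy|y ->] /=; last first.
      by move=> k _; split => //=; rewrite in_itv/=; apply/andP; split;
        rewrite ?lerBlDr ?lerDl.
    apply/eqP; rewrite -subr_eq0 -normr_eq0 eq_le normr_ge0 andbT.
    apply/ler_addgt0Pl => e e0; rewrite addr0.
    have [k ek] : exists k : nat, k.+1%:R^-1 < e.
      exists (Num.Def.archi_bound e^-1).
      rewrite invf_plt ?posrE//.
      by rewrite (lt_trans (archi_boundP _))// ?invr_ge0 ?ltW// ltr_nat.
    have [_ /=] := Dy k I; rewrite in_itv/= => /andP[y1 y2].
    rewrite ler_distl; apply/andP; split.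
      by rewrite (le_trans _ y1)// lerD2l lerN2 ltW.
    by rewrite (le_trans y2)// lerD2l ltW.
  have [n n0] : exists n, mu (D `&` `[x - n.+1%:R^-1, x + n.+1%:R^-1]) = 0%E.
    apply: contrapT => /forallNP n0.
    have [K KE] := muN _ mD (@subset_refl _ _).
    have : (mu \o (fun k => D `&` `[x - k.+1%:R^-1, x + k.+1%:R^-1])) n @[n --> \oo] -->
           mu (\bigcap_k (D `&` `[x - k.+1%:R^-1, x + k.+1%:R^-1])).
      apply: nonincreasing_cvg_mu => /=.
      - have [|j ->] := muN (D `&` `[x - 1%:R^-1, x + 1%:R^-1]) _ (@subIsetl _ _ _).
          exact: measurableI.
        by rewrite ltry.
      - by move=> i; exact: measurableI.
      - by rewrite capE; exact: measurable_set1.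
      - move=> i j ij; apply/subsetPset; apply: setIS => y /=.
        rewrite !in_itv/= => /andP[y1 y2].
        have : j.+1%:R^-1 <= i.+1%:R^-1 :> R by rewrite lef_pV2 ?posrE// ler_nat.
        move=> ijV; apply/andP; split.
          by rewrite (le_trans _ y1)// lerD2l lerN2.
        by rewrite (le_trans y2)// lerD2l.
    rewrite capE => cvmu.
    have : (1 <= mu [set x])%E.
      apply: (cvge_to_ge cvmu).
      apply: nearW => k /=.
      have [|j jE] := muN (D `&` `[x - k.+1%:R^-1, x + k.+1%:R^-1]) _ (@subIsetl _ _ _).
        exact: measurableI.
      have := n0 k; rewrite jE; case: j {jE} => // j _.
      by rewrite lee_fin ler1n.
    have [->|mux] := eqVneq (mu [set x]) 0%E; first by rewrite leNgt lte01.
    by exfalso; apply: noatom; exists x.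
  have xn : cell (Num.Def.floor (x * n.+1%:R)) n x.
    have /andP[x1 x2] := floor_itv (x * n.+1%:R).
    by rewrite /cell /= in_itv/= ler_pdivrMr// ltr_pdivlMr// x1.
  exists (pickle (Num.Def.floor (x * n.+1%:R), n)); first exact: I.
  rewrite /G pickleK ifT; first by split.
  apply/eqP/le_anti; rewrite measure_ge0 andbT -n0.
  apply: le_measure; rewrite ?inE//; first exact: measurableI.
  apply: setIS => y; move: xn; rewrite /cell /= !in_itv/= intrD mulrDl div1r.
  move=> /andP[x1 x2] /andP[y1 y2].
  rewrite lerBlDr (le_trans (ltW x2)) ?lerD2r//=.
  by rewrite (le_trans (ltW y2)) ?lerD2r.
apply/(negligibleP _ mD); rewrite GD; apply: negligible_bigcup => p.
rewrite /G; case: unpickle => [[z n]|]; last exact: negligible_set0.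
case: ifP => [/eqP m0|_]; last exact: negligible_set0.
exact/negligibleP.
Qed.

(** Strong induction on the integer [mu D]: removing an atom lowers it by at least 1. *)
Lemma integer_measure_atoms (R : realType)
    (mu : {measure set (measurableTypeR R) -> \bar R})
    (D : set (measurableTypeR R)) : measurable D ->
  (forall B, measurable B -> B `<=` D -> exists k : nat, mu B = k%:R%:E) ->
  exists L : seq (measurableTypeR R), [/\ uniq L, (forall s, s \in L -> D s) &
    forall B, measurable B -> B `<=` D ->
      (mu B = \sum_(s <- L) mu [set s] * \d_s B)%E].
Proof.
move=> mD muN; have [k kE] := muN _ mD (@subset_refl _ _).
elim/ltn_ind: k => k IH in D mD muN kE *.
have [D0|D0] := eqVneq (mu D) 0%E.
  exists [::]; split => // B mB BD; rewrite big_nil; apply/eqP.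
  rewrite eq_le measure_ge0 andbT -D0.
  by apply: le_measure; rewrite ?inE.
have [s Ds s0] := ex_atom mD muN D0.
have ms : measurable ([set s] : set (measurableTypeR R)) by exact: measurable_set1.
have [j jE] : exists j : nat, mu [set s] = j%:R%:E by apply: muN => // x ->.
have [i iE] : exists i : nat, mu (D `\ s) = i%:R%:E.
  by apply: muN; [exact: measurableD|exact: subDsetl].
have ik : (i < k)%N.
  have : (i%:R%:E + j%:R%:E = k%:R%:E :> \bar R)%E.
    rewrite -kE (measureDI mu mD ms); congr (_ + _)%E; first exact/esym.
    rewrite -jE; congr (mu _).
    by apply/seteqP; split=> [x ->//|x []].
  rewrite -EFinD -natrD => -[/eqP]; rewrite eqr_nat => /eqP <-.
  rewrite -[X in (X < _)%N]addn0 ltn_add2l lt0n.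
  by apply: contraNneq s0 => j0; rewrite jE j0.
have mDs : measurable (D `\ s) by exact: measurableD.
have [|L [uL LD Lmu]] := IH _ ik _ mDs _ iE.
  by move=> B mB BD; apply: muN => // x /BD[].
exists (s :: L); split => /=.
- rewrite uL andbT; apply/negP => /LD [_ ]; exact.
- by move=> x; rewrite inE => /predU1P[->//|/LD[]].
move=> B mB BD; rewrite big_cons (measureDI mu mB ms) addeC; congr (_ + _)%E.
  have [Bs|Bs] := pselect (B s).
    rewrite diracE mem_set// mule1; congr (mu _).
    by apply/seteqP; split=> [x []//|x ->].
  rewrite diracE memNset// mule0 (_ : B `&` _ = set0) ?measure0//.
  by apply/seteqP; split=> // x [Bx xs]; apply: Bs; rewrite -xs.
have BDs : B `\ s `<=` D `\ s by move=> x [/BD ? ?]; split.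
apply: etrans (Lmu _ (measurableD mB ms) BDs) _.
rewrite big_seq [RHS]big_seq; apply: eq_bigr => x xL; congr (_ * _)%E.
have [_ /= xs] := LD _ xL.
have [Bx|Bx] := pselect (B x); first by rewrite !diracE !mem_set.
by rewrite !diracE !memNset// => -[].
Qed.

(* Integrals of nonnegative functions are suprema over simple functions, so
   they are monotone without measurability; the supremum over [theta] in the
   theorem need not be measurable. *)
Lemma ge0_le_integral_nonmeasurable d (T : measurableType d) (R : realType)
    (mu : {measure set T -> \bar R}) (D : set T) (f g : T -> \bar R) :
  (forall x, D x -> 0 <= f x)%E -> (forall x, D x -> f x <= g x)%E ->
  (\int[mu]_(x in D) f x <= \int[mu]_(x in D) g x)%E.
Proof.
move=> f0 fg; have g0 x : D x -> (0 <= g x)%E.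
  by move=> Dx; rewrite (le_trans (f0 _ Dx)) ?fg.
rewrite !ge0_integralE//; apply: ereal_sup_le => _ [k /= kf <-].
exists k => //= x; apply: (le_trans (kf x)); rewrite /patch.
by case: ifPn => // /set_mem; exact: fg.
Qed.

(** The representation by Dirac masses is assumed only inside [D], because a point process is a
    finite sum of Dirac masses on bounded sets only. *)
Lemma ge0_integral_finitely_supported d (T : measurableType d) (R : realType)
    (mu : {measure set T -> \bar R}) (D : set T) (I : eqType) (L : seq I)
    (a : I -> R) (p : I -> T) (f : T -> \bar R) :
  measurable D -> measurable_fun D f -> (forall x, D x -> 0 <= f x)%E ->
  (forall i, i \in L -> 0 <= a i) -> (forall i, i \in L -> D (p i)) ->
  (forall B, measurable B -> B `<=` D ->
     mu B = \sum_(i <- L) (a i)%:E * \d_(p i) B)%E ->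
  (\int[mu]_(x in D) f x = \sum_(i <- L) (a i)%:E * f (p i))%E.
Proof.
move=> mD mf f0; case: L => [|i0 L'] a0 Dp muE.
  rewrite big_nil -(integral_measure_zero D f); apply: eq_measure_integral => B mB BD.
  by rewrite muE// big_nil.
set L := i0 :: L' in a0 Dp muE *.
(* A scaled measure takes a nonnegative factor at every index, hence the absolute value, which is
   harmless on [L]. *)
pose m n : {measure set T -> \bar R} :=
  mscale (NngNum (normr_ge0 (a (nth i0 L n)))) (\d_(p (nth i0 L n))).
rewrite (eq_measure_integral (msum m (size L))); last first.
  move=> B mB BD; rewrite muE// (big_nth i0) big_mkord /msum /=.
  apply: eq_bigr => n _; have nL : nth i0 L n \in L by rewrite mem_nth.
  by congr (_%:E * _)%E; rewrite /= ger0_norm ?a0.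
rewrite ge0_integral_measure_sum// (big_nth i0) big_mkord.
apply: eq_bigr => n _; have nL : nth i0 L n \in L by rewrite mem_nth.
rewrite ge0_integral_mscale//= integral_dirac//= diracE mem_set; last exact: Dp.
by rewrite mul1e ger0_norm ?a0.
Qed.

Lemma integral_finitely_supported d (T : measurableType d) (R : realType)
    (mu : {measure set T -> \bar R}) (D : set T) (I : eqType) (L : seq I)
    (a : I -> R) (p : I -> T) (f : T -> R) :
  measurable D -> measurable_fun D f ->
  (forall i, i \in L -> 0 <= a i) -> (forall i, i \in L -> D (p i)) ->
  (forall B, measurable B -> B `<=` D ->
     mu B = \sum_(i <- L) (a i)%:E * \d_(p i) B)%E ->
  (\int[mu]_(x in D) (f x)%:E = (\sum_(i <- L) a i * f (p i))%:E)%E.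
Proof.
move=> mD mf a0 Dp muE; have mfE : measurable_fun D (EFin \o f).
  exact/measurable_EFinP.
rewrite integralE !(@ge0_integral_finitely_supported _ _ _ _ D _ L a p)//; last first.
  exact: measurable_funepos.
  exact: measurable_funeneg.
rewrite funepos.unlock funeneg.unlock /=.
under eq_bigr do rewrite -EFin_max -EFinM.
under [X in (_ - X)%E]eq_bigr do rewrite -EFin_max -EFinM.
rewrite !sumEFin -EFinB -sumrB; congr EFin; apply: eq_bigr => i _.
rewrite -mulrBr; congr (_ * _); rewrite /Num.max.
have [fi|fi|->] := ltrgtP (f (p i)) 0.
- by rewrite oppr_lt0 ltNge (ltW fi)/= sub0r opprK.
- by rewrite oppr_lt0 fi subr0.
- by rewrite oppr0 ltxx subr0.
Qed.

(** * Derivatives of the exponential kernel *)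

Section derivatives_on_rows.
Context {R : realType}.

(** Both derivatives are limits of the same difference quotients. *)
Lemma is_derive_line (V W : normedModType R) (f : V -> W) (x v : V) (df : W) :
  is_derive (0 : R) 1 (fun s : R => f (s *: v + x)) df -> is_derive x v f df.
Proof.
have E : (fun s : R => s^-1 *: (((fun s : R => f (s *: v + x)) \o shift 0)
      (s *: (1 : R)) - f (0 *: v + x))) =
    (fun s : R => s^-1 *: ((f \o shift x) (s *: v) - f x)).
  apply/funext => s /=; rewrite scale0r add0r addr0.
  by rewrite (_ : s *: 1 = s) // /GRing.scale /= mulr1.
by move=> [d1 d2]; split; [move: d1; rewrite /derivable E|move: d2; rewrite /derive E].
Qed.

Lemma is_derive_scale_cst (V W : normedModType R) (f : V -> R) (x v : V)
    (df : R) (u : W) :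
  is_derive x v f df -> is_derive x v (fun z => f z *: u) (df *: u).
Proof.
move=> [d1 d2].
have c : (h^-1 *: (((fun z => f z *: u) \o shift x) (h *: v) - f x *: u))
    @[h --> 0^'] --> df *: u.
  under eq_cvg do rewrite /= -scalerBl scalerA.
  rewrite -d2; exact: cvgZr_tmp.
by split; [apply/cvg_ex; exists (df *: u)|exact/cvg_lim].
Qed.

(* The partial derivative of [theta |-> vartheta * alpha * exp (- alpha * tau)]
   of multi-order (z, a, m) in (eta, vartheta, alpha). *)
Definition kernel_partial (z a m : nat) (tau : R) (theta : 'rV[R]_3) : R :=
  (z == 0%N)%:R * (if a is 0%N then branching theta else (a == 1%N)%:R) *
  (((- tau) ^+ m * decay theta + m%:R * (- tau) ^+ m.-1) *
   expR (- decay theta * tau)).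

(** Along the direction [j], [decay] and [branching] are affine with slope 0 or 1. The shape is
    stable because the [m]-th derivative of [D * exp (- D tau)] in [D] is [((- tau)^m D + m (-
    tau)^(m-1)) exp (- D tau)]; at [m = 0] the truncated predecessor is multiplied by 0. *)
Lemma is_derive_kernel_partial (z a m : nat) (tau : R) (theta : 'rV[R]_3)
    (j : 'I_3) :
  is_derive theta (unitv j) (kernel_partial z a m tau)
    (kernel_partial (z + (j == 0%N :> nat)) (a + (j == 1%N :> nat))
       (m + (j == 2%N :> nat)) tau theta).
Proof.
apply: is_derive_line.
set d0 := decay theta; set b0 := branching theta.
have dE s : decay (s *: unitv j + theta) = d0 + (j == 2%N :> nat)%:R * s.
  rewrite /decay !mxE eqxx /= addrC; congr (_ + _).
  by rewrite mulrC; congr (_%:R * _); rewrite eq_sym.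
have bE s : branching (s *: unitv j + theta) = b0 + (j == 1%N :> nat)%:R * s.
  rewrite /branching !mxE eqxx /= addrC; congr (_ + _).
  by rewrite mulrC; congr (_%:R * _); rewrite eq_sym.
rewrite /kernel_partial.
under eq_fun do rewrite dE bE.
rewrite -/d0 -/b0; clearbody d0 b0.
have fM (u v : R -> R) s : (u * v) s = u s * v s by [].
set e1 : R := (j == 1%N :> nat)%:R; set e2 : R := (j == 2%N :> nat)%:R.
have affine (c k : R) : is_derive (0 : R) 1 (fun s => c + k * s) k.
  have : is_derive (0 : R) 1 (cst c + cst k * id) (0 + (k *: 1 + 0 *: 0)).
    by apply: is_deriveD; apply: is_deriveM.
  by rewrite /cst /= scale0r addr0 add0r /GRing.scale /= mulr1.
have dexp : is_derive (0 : R) 1 (fun s => expR (- (d0 + e2 * s) * tau))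
    (expR (- d0 * tau) * (- e2 * tau)).
  have -> : (fun s => expR (- (d0 + e2 * s) * tau)) =
    expR \o (fun s => - d0 * tau + (- e2 * tau) * s).
    by apply/funext => s /=; congr expR; ring.
  apply: is_derive1_comp; rewrite mulr0 addr0; exact: is_derive_expR.
pose g (s : R) : R := if a is 0%N then b0 + e1 * s else (a == 1%N)%:R.
have dg : is_derive (0 : R) 1 g (if a is 0%N then e1 else 0).
  rewrite {}/g; case: (a) => [|a']; [exact: affine|exact: is_derive_cst].
pose p (s : R) : R := (- tau) ^+ m * d0 + m%:R * (- tau) ^+ m.-1 +
  ((- tau) ^+ m * e2) * s.
have dp : is_derive (0 : R) 1 p ((- tau) ^+ m * e2) by exact: affine.
have -> : (fun s => (z == 0%N)%:R * (if a is 0%N then b0 + e1 * s else (a == 1%N)%:R) *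
    (((- tau) ^+ m * (d0 + e2 * s) + m%:R * (- tau) ^+ m.-1) *
     expR (- (d0 + e2 * s) * tau))) =
  cst (z == 0%N)%:R * g * (p * (fun s => expR (- (d0 + e2 * s) * tau))).
  by apply/funext => s; rewrite !fM; congr (_ * (_ * _)); rewrite /p; ring.
apply: is_derive_eq; rewrite /GRing.scale /= /g /p !fM /= !mulr0 !addr0 /e1 /e2.
clear.
case: j => [] [|[|[|//]]] /= _; rewrite ?addn0 ?addn1 /=.
- by case: (a) => [|a'] /=; ring.
- by case: (a) => [|a'] /=; ring.
by case: (a) (m) => [|a'] [|m'] /=; rewrite ?exprS; ring.
Qed.
End derivatives_on_rows.

Section kernel_derivatives.
Context {R : realType}.

(** Each derivative raises exactly one of the three orders, so only the number of occurrences of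
    each coordinate in [s] matters. *)
Lemma iter_partial_kernel_sum (V : normedModType R) (I : Type) (L : seq I)
    (tau : I -> R) (u : I -> V) (s : seq 'I_3) :
  iter_partial s
    (fun theta => \sum_(i <- L) kernel_partial 0 0 0 (tau i) theta *: u i) =
  (fun theta => \sum_(i <- L)
     kernel_partial (count (fun j : 'I_3 => j == 0%N :> nat) s)
       (count (fun j : 'I_3 => j == 1%N :> nat) s)
       (count (fun j : 'I_3 => j == 2%N :> nat) s) (tau i) theta *: u i).
Proof.
elim: s => [//|j s IH] /=; rewrite {}IH; apply/funext => theta.
set z := count _ s; set a := count _ s; set m := count _ s.
apply: derive_val; elim: L => [|i L IH].
  under eq_fun do rewrite big_nil; rewrite big_nil.
  exact: is_derive_cst.
under eq_fun do rewrite big_cons; rewrite big_cons.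
apply: is_deriveD => //; apply: is_derive_scale_cst.
by rewrite (addnC _ z) (addnC _ a) (addnC _ m); exact: is_derive_kernel_partial.
Qed.

(** The polynomial factor, of degree at most 2 in [tau], is absorbed by the gap between the rates
    [a_lo] and [beta]. *)
Lemma kernel_partial_le (b_hi a_lo a_hi beta : R) :
  0 <= b_hi -> 0 <= a_hi -> beta < a_lo ->
  exists2 C : R, 0 <= C & forall (z a m : nat) (tau : R) (theta : 'rV[R]_3),
    (m <= 2)%N -> 0 <= tau ->
    0 <= branching theta <= b_hi -> 0 <= a_lo <= decay theta ->
    decay theta <= a_hi ->
    `|kernel_partial z a m tau theta| <= C * expR (- beta * tau).
Proof.
move=> bhi0 ahi0 beta_lt; pose k := a_lo - beta.
have k0 : 0 < k by rewrite subr_gt0.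
have K0 : 0 <= 2 + 4 / k ^+ 2 by rewrite addr_ge0// divr_ge0// sqr_ge0.
exists ((1 + b_hi) * ((1 + a_hi) * (2 + 4 / k ^+ 2))).
  by rewrite !mulr_ge0// addr_ge0.
move=> z a m tau theta m2 tau0 /andP[b0 bhi] /andP[alo0 alo] ahi.
set D := decay theta in alo ahi *; have D0 : 0 <= D by exact: le_trans alo.
have poly : `|(- tau) ^+ m * D + m%:R * (- tau) ^+ m.-1| <=
    (1 + a_hi) * (1 + tau) ^+ 2.
  have tD : tau * D <= tau * a_hi by rewrite ler_wpM2l.
  have ta : 0 <= tau * a_hi by rewrite mulr_ge0.
  have tD0 : 0 <= tau * D by rewrite mulr_ge0.
  have t2a : 0 <= tau * (tau * a_hi) by rewrite mulr_ge0.
  have t2D : tau * (tau * D) <= tau * (tau * a_hi) by rewrite ler_wpM2l.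
  have t2D0 : 0 <= tau * (tau * D) by rewrite mulr_ge0.
  have t20 : 0 <= tau * tau by rewrite mulr_ge0.
  case: m m2 => [|[|[|//]]] _ /=; rewrite ler_norml; apply/andP; split; nra.
(* Here [(1 + tau)^2 <= 2 + 2 tau^2], and the factor [2 + 4 / k^2] makes the bound
   [1 + (k tau)^2 / 2] of the exponential dominate both terms. *)
have expo : (1 + tau) ^+ 2 <= (2 + 4 / k ^+ 2) * expR (k * tau).
  have := @expR_ge1Dxn R (k * tau) 1 (mulr_ge0 (ltW k0) tau0).
  rewrite (_ : 2`!%:R = 2 :> R)// => /(ler_wpM2l K0); apply: le_trans.
  rewrite [leRHS](_ : _ = 2 + 4 / k ^+ 2 + (k * tau) ^+ 2 + 2 * tau ^+ 2).
    have : 0 <= 4 / k ^+ 2 by rewrite divr_ge0// sqr_ge0.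
    have := sqr_ge0 (k * tau); have := sqr_ge0 (tau - 1); nra.
  by field; rewrite gt_eqF.
rewrite /kernel_partial !normrM -/D -!mulrA.
have z1 : `|(z == 0%N)%:R : R| <= 1 by case: (z == 0%N); rewrite ?normr1 ?normr0.
have a1 : `|if a is 0%N then branching theta else (a == 1%N)%:R : R| <= 1 + b_hi.
  case: a => [|a]; first by rewrite ger0_norm// (le_trans bhi)// lerDr.
  by case: eqP; rewrite ?normr1 ?normr0 ?lerDl// addr_ge0.
rewrite (le_trans (ler_piMl _ z1)) ?mulr_ge0//.
rewrite ler_pM// ?mulr_ge0//.
rewrite (@le_trans _ _ (((1 + a_hi) * ((2 + 4 / k ^+ 2) * expR (k * tau))) *
    expR (- a_lo * tau)))//.
  rewrite ler_pM//.
    by rewrite (le_trans poly)// ler_wpM2l// addr_ge0.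
  by rewrite ger0_norm ?expR_ge0// ler_expR !mulNr lerN2 ler_wpM2r.
rewrite -!mulrA -expRD ler_wpM2l// ?addr_ge0//.
by rewrite ler_wpM2l// ler_expR /k; nra.
Qed.

End kernel_derivatives.

(** The constant is chosen before the points, the lags and the vectors, so it serves all paths and
    all times at once. *)
Lemma norm_partials_kernel_sum_le (R : realType) (b_hi a_lo a_hi beta : R) :
  0 <= b_hi -> 0 <= a_hi -> beta < a_lo ->
  exists2 C : R, 0 <= C &
  forall (V : normedModType R) (I : eqType) (L : seq I) (tau : I -> R)
    (u : I -> V) (i : nat) (theta : 'rV[R]_3), (i <= 2)%N ->
    (forall l, l \in L -> 0 <= tau l) ->
    0 <= branching theta <= b_hi -> 0 <= a_lo <= decay theta ->
    decay theta <= a_hi ->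
    norm_partials i
      (fun theta => \sum_(l <- L) kernel_partial 0 0 0 (tau l) theta *: u l)
      theta <=
    C * \sum_(l <- L) expR (- beta * tau l) * `|u l|.
Proof.
move=> b0 a0 bl; have [C C0 CP] := kernel_partial_le b0 a0 bl; exists C => //.
move=> V I L tau u i theta i2 tau0 bt dt dt'.
apply: bigmax_le => [|s _].
  by rewrite mulr_ge0// sumr_ge0// => l _; rewrite mulr_ge0 ?expR_ge0.
rewrite iter_partial_kernel_sum (le_trans (ler_norm_sum _ _ _))//.
rewrite mulr_sumr big_seq [leRHS]big_seq ler_sum// => l lL.
rewrite normrZ mulrA ler_wpM2r// CP ?tau0//.
by rewrite (leq_trans _ i2)// -[leqRHS](size_tuple s) count_size.
Qed.

Lemma measurable_exp_kernel (R : realType) (t a : R) :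
  measurable_fun setT (fun s : measurableTypeR R => exp_kernel (t - s) a).
Proof.
apply: measurable_funM => //; apply: measurableT_comp => //.
apply: measurable_funM => //; exact: measurable_funB.
Qed.

(** Over [[0, t[] the marked integral is a finite sum, so it is differentiated in [psi] term by
    term; [dpsi_g] identifies the derivative of the boost at 0 with the score. *)
Lemma dpsi_lambda_gE (R : realType) (d q r : nat)
    (X : set (d.-tuple (measurableTypeR R)))
    (f : d.-tuple (measurableTypeR R) -> 'rV[R]_q -> R)
    (h : d.-tuple (measurableTypeR R) -> 'rV[R]_r -> R)
    (Phi : set 'rV[R]_q) (Psi : set 'rV[R]_r) (phi : 'rV[R]_q)
    (n : {measure set (measurableTypeR R) -> \bar R})
    (ng : {measure set (measurableTypeR R * d.-tuple (measurableTypeR R))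
      -> \bar R})
    (ys : measurableTypeR R -> d.-tuple (measurableTypeR R))
    (L : seq (measurableTypeR R)) (a : R -> R) (t : R) (theta : 'rV[R]_3) :
  measurable X -> boost_conditions X f h Phi Psi phi ->
  measurable_fun setT ys -> (forall s, X (ys s)) ->
  (forall A : set (measurableTypeR R * d.-tuple (measurableTypeR R)),
     measurable A -> ng A = n [set s | A (s, ys s)]) ->
  (forall s, 0 <= a s) -> (forall s, s \in L -> 0 <= s < t) ->
  (forall B : set (measurableTypeR R), measurable B -> B `<=` `[0%R, t[ ->
     n B = \sum_(s <- L) (a s)%:E * \d_s B)%E ->
  dpsi_lambda_g X f h ng t theta phi 0 =
  \sum_(s <- L) kernel_partial 0 0 0 (t - s) theta *:
    (a s *: scoreG X f h phi (ys s)).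
Proof.
move=> mX bc mys Xys ngE a0 Lt nE.
pose D : set (measurableTypeR R * d.-tuple (measurableTypeR R)) := `[0, t[ `*` X.
have mD : measurable D by apply: measurableX => //; exact: measurable_itv.
have lamE psi : lambda_g X f h ng t theta phi psi = base_rate theta +
    branching theta * \sum_(s <- L) a s *
      (exp_kernel (t - s) (decay theta) * boost X f h (ys s) phi psi).
  rewrite /lambda_g; congr (_ + _ * _); rewrite /Rintegral.
  pose g (z : measurableTypeR R * d.-tuple (measurableTypeR R)) :=
    exp_kernel (t - z.1) (decay theta) * boost X f h z.2 phi psi.
  rewrite (@integral_finitely_supported _ _ _ _ D _ L a (fun s => (s, ys s)) g)//.
  - apply: measurable_funM.
      apply: measurable_funTS; apply: measurableT_comp (measurable_exp_kernel _ _) _.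
      exact: measurable_fst.
    apply: measurable_funM => //.
    rewrite (_ : (fun _ => _) = (h ^~ psi) \o snd)//.
    apply: (@measurable_comp _ _ _ _ _ _ X) => //.
    - by move=> _ [z [_ Xz] <-].
    - exact: h_measurable bc _.
    - by apply: measurable_funTS; exact: measurable_snd.
  - by move=> s sL; split; [rewrite /= in_itv/= Lt|exact: Xys].
  - move=> B mB BD; rewrite ngE// nE//.
      by rewrite -[X in measurable X]setTI; apply: measurable_fun_pair.
    by move=> s /BD[].
apply/rowP => l; rewrite mxE summxE.
rewrite (funext lamE).
have dS : is_derive (0 : 'rV[R]_r) (unitv l)
    (fun psi => \sum_(s <- L) a s *
       (exp_kernel (t - s) (decay theta) * boost X f h (ys s) phi psi))
    (\sum_(s <- L) a s *
       (exp_kernel (t - s) (decay theta) * scoreG X f h phi (ys s) 0 l)).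
  elim: (L) => [|s L' IH].
    by under eq_fun do rewrite big_nil; rewrite big_nil; exact: is_derive_cst.
  under eq_fun do rewrite big_cons; rewrite big_cons.
  apply: is_deriveD => //.
  exact: (is_deriveZ _ (is_deriveZ _ (dpsi_g bc l (Xys s)))).
have dlam := is_deriveD (is_derive_cst (base_rate theta) (0 : 'rV[R]_r) (unitv l))
  (is_deriveZ (branching theta) dS).
apply: etrans (@derive_val _ _ _ _ _ _ _ dlam) _.
rewrite add0r /GRing.scale /= mulr_sumr.
apply: eq_bigr => s _; rewrite !mxE /kernel_partial /exp_kernel /=; ring.
Qed.

(** * Adaptively thinned Poisson counts *)

Section adaptive_counts.
Context d (T : measurableType d) {R : realType}.
Variable B : seq nat -> set T.

(* The counts of a point process on the sets [B [::]], [B [:: k0]],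
   [B [:: k0; k1]], ..., each set being chosen in view of the previous counts. *)
Fixpoint adaptive_counts (mu : set T -> \bar R) (n : nat) : seq nat :=
  if n is j.+1 then
    let k := adaptive_counts mu j in rcons k (Num.trunc (fine (mu (B k))))
  else [::].

Lemma size_adaptive_counts mu n : size (adaptive_counts mu n) = n.
Proof. by elim: n => //= n IH; rewrite size_rcons IH. Qed.

(** The index type is arbitrary because three families occur: a kernel, the same kernel on a coarser
    sigma-algebra, and a single measure indexed by [unit]. *)
Definition counts_cell (Om : Type) (M : Om -> {measure set T -> \bar R}) (k : seq nat) :
    set Om :=
  [set om | adaptive_counts (M om) (size k) = k].

Lemma counts_cell_nil Om (M : Om -> {measure set T -> \bar R}) :
  counts_cell M [::] = setT.
Proof. by apply/seteqP; split. Qed.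

Section integer_valued.
Variables (Om : Type) (M : Om -> {measure set T -> \bar R}).
Hypothesis M_nat : forall om k, exists j : nat, M om (B k) = j%:R%:E.

Lemma counts_cell_rcons k m :
  counts_cell M (rcons k m) =
  counts_cell M k `&` [set om | M om (B k) = m%:R%:E].
Proof.
rewrite /counts_cell size_rcons /=; apply/seteqP; split=> om /=.
  move=> /rcons_inj[-> <-]; split=> //.
  by have [j ->] := M_nat om k; rewrite /= natrK.
by move=> [-> ->]; rewrite /= natrK.
Qed.

(** Once the history is prescribed, the sets being counted are deterministic. This lets independence
    over fixed disjoint sets act on adaptively chosen ones. *)
Lemma counts_cell_bigcap k :
  counts_cell M k =
  \bigcap_(i : 'I_(size k)) [set om | M om (B (take i k)) = (nth 0%N k i)%:R%:E].
Proof.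
elim/last_ind: k => [|k m IH].
  by rewrite counts_cell_nil; apply/seteqP; split=> // om _ [].
rewrite counts_cell_rcons IH; apply/seteqP; split=> om /=.
  move=> [H1 H2] [i /=]; rewrite size_rcons ltnS leq_eqVlt => /orP[/eqP ->|ik] _ /=.
    by rewrite -cats1 take_size_cat// nth_cat ltnn subnn.
  rewrite -cats1 takel_cat ?(ltnW ik)// nth_cat ik.
  exact: (H1 (Ordinal ik) I).
move=> H; split.
  move=> [i ik] _ /=; have ik' : (i < size (rcons k m))%N by rewrite size_rcons ltnW.
  have := H (Ordinal ik') I => /=.
  by rewrite -cats1 takel_cat ?(ltnW ik)// nth_cat ik.
have ik' : (size k < size (rcons k m))%N by rewrite size_rcons.
have := H (Ordinal ik') I => /=.
by rewrite -cats1 take_size_cat// nth_cat ltnn subnn.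
Qed.

Lemma counts_cell_split k : counts_cell M k = \bigcup_m counts_cell M (rcons k m).
Proof.
apply/seteqP; split=> om.
  move=> Ak; have [j jE] := M_nat om k.
  by exists j => //; rewrite counts_cell_rcons; split.
by move=> [m _]; rewrite counts_cell_rcons => -[].
Qed.

Lemma trivIset_counts_cell_rcons k :
  trivIset setT (fun m => counts_cell M (rcons k m)).
Proof.
move=> i j _ _ [om []]; rewrite !counts_cell_rcons => -[_ /= ->] [_ /= [/eqP]].
by rewrite eqr_nat => /eqP.
Qed.

End integer_valued.

Lemma measurable_counts_cell dO (Om : measurableType dO) (M : R.-ker Om ~> T) k :
  (forall k, measurable (B k)) ->
  (forall om k, exists j : nat, M om (B k) = j%:R%:E) ->
  measurable (counts_cell M k).
Proof.
move=> mB Mnat; elim/last_ind: k => [|k m IH]; first by rewrite counts_cell_nil.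
rewrite counts_cell_rcons//; apply: measurableI => //.
rewrite -[X in measurable X]setTI.
have mM := measurable_kernel M _ (mB k) measurableT [set m%:R%:E] (emeasurable_set1 _).
exact: mM.
Qed.

End adaptive_counts.

(** A supermartingale argument without conditional expectations: [p k] gives the law of the next
    count after the history [k], [Phi] is superharmonic for it, and the bound travels back from
    histories of length [J] to the empty one. *)
Lemma ge0_integral_cells_le d (T : measurableType d) (R : realType)
    (dO : measure_display) (Om : measurableType dO) (P : probability Om R)
    (M : R.-ker Om ~> T) (B : seq nat -> set T) (p : seq nat -> nat -> R)
    (J : nat) (U : Om -> \bar R) (Phi : seq nat -> R) :
  (forall k, measurable (B k)) ->
  (forall om k, exists j : nat, M om (B k) = j%:R%:E) ->
  (forall k m, P (counts_cell B M (rcons k m)) =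
     P (counts_cell B M k) * (p k m)%:E)%E ->
  measurable_fun setT U -> (forall om, 0 <= U om)%E ->
  (forall k m, 0 <= p k m) -> (forall k, 0 <= Phi k) ->
  (forall k, size k = J ->
     \int[P]_(om in counts_cell B M k) U om <= (Phi k)%:E * P (counts_cell B M k))%E ->
  (forall k, (size k < J)%N ->
     \sum_(0 <= m <oo) (p k m * Phi (rcons k m))%:E <= (Phi k)%:E)%E ->
  (\int[P]_om U om <= (Phi [::])%:E)%E.
Proof.
move=> mB Mnat PM mU U0 p0 Phi0 final step.
have mA := measurable_counts_cell _ mB Mnat.
(* Induction on the number [n] of counts still to be revealed. *)
suff cells n k : (size k + n)%N = J ->
    (\int[P]_(om in counts_cell B M k) U om <= (Phi k)%:E * P (counts_cell B M k))%E.
  by have := cells J [::] erefl; rewrite counts_cell_nil probability_setT mule1.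
elim: n k => [|n IH] k; first by rewrite addn0; exact: final.
move=> kn; rewrite counts_cell_split// ge0_integral_bigcup//; last 2 first.
- exact: measurable_funTS.
- exact: trivIset_counts_cell_rcons.
apply: (@le_trans _ _ (\sum_(0 <= m <oo)
    (p k m * Phi (rcons k m))%:E * P (counts_cell B M k))%E).
  apply: lee_nneseries => [m _ _|m _]; first exact: integral_ge0.
  rewrite (le_trans (IH (rcons k m) _)) ?size_rcons ?addSnnS//.
  by rewrite PM muleCA -EFinM muleC [Phi _ * _]mulrC.
rewrite -counts_cell_split//.
have [C CE] : exists C : R, P (counts_cell B M k) = C%:E.
  by exists (fine (P (counts_cell B M k))); rewrite fineK ?fin_num_measure.
have C0 : (0 <= C%:E :> \bar R)%E by rewrite -CE measure_ge0.
apply: (@le_trans _ _ (C%:E * (Phi k)%:E)%E); last first.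
  by rewrite [leRHS]muleC; apply: lee_wpmul2r; rewrite ?lee_fin// -CE.
apply: (@le_trans _ _ (\sum_(0 <= m <oo) C%:E * (p k m * Phi (rcons k m))%:E)%E).
  apply: lee_nneseries => [m _ _|m _]; last by rewrite muleC -CE.
  by rewrite mule_ge0// lee_fin mulr_ge0.
rewrite nneseriesZl; last by move=> m _; rewrite lee_fin mulr_ge0.
rewrite lee_wpmul2l// step//.
by rewrite -kn -addSnnS leq_addr.
Qed.

(** * Poisson transitions and an exponential Lyapunov function *)

Definition poisson_weight {R : realType} (v : R) (m : nat) : R :=
  expR (- v) * v ^+ m / m`!%:R.

Lemma poisson_weight_ge0 {R : realType} (v : R) m : 0 <= v -> 0 <= poisson_weight v m.
Proof. by move=> v0; rewrite /poisson_weight divr_ge0// mulr_ge0 ?expR_ge0 ?exprn_ge0. Qed.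

(** The factor [expR (y * m)] turns the Poisson weights into the exponential series at
    [v * expR y]. *)
Lemma poisson_exponential_moment (R : realType) (v y : R) : 0 <= v ->
  (\sum_(0 <= m <oo) (poisson_weight v m * expR (y * m%:R))%:E =
   (expR (v * (expR y - 1)))%:E)%E.
Proof.
move=> v0; have x0 : 0 <= v * expR y by rewrite mulr_ge0 ?expR_ge0.
rewrite (_ : (fun n => \sum_(0 <= m < n) _)%E =
    EFin \o (expR (- v) \*: series (exp_coeff (v * expR y)))); last first.
  apply/funext => n /=; rewrite sumEFin; congr EFin.
  rewrite /series /= scaler_sumr; apply: eq_bigr => m _.
  rewrite /poisson_weight /exp_coeff /= exprMn -expRM_natr /GRing.scale /=.
  by ring.
rewrite EFin_lim; last by apply: is_cvgZl_tmp; exact: is_cvg_series_exp_coeff.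
congr EFin; rewrite (limZl_tmp _ (is_cvg_series_exp_coeff _)).
by rewrite /GRing.scale /= -expRD; congr expR; ring.
Qed.

(** Both cells prescribe counts over deterministic disjoint sets, so their probabilities are
    products that differ by the last factor only. *)
Lemma poisson_counts_cell (R : realType) (dO : measure_display)
    (Omega : measurableType dO) (P : probability Omega R)
    (M : R.-ker Omega ~> (measurableTypeR R * measurableTypeR R)%type)
    (B : seq nat -> set (measurableTypeR R * measurableTypeR R))
    (v : seq nat -> R) (k : seq nat) (m : nat) :
  poisson_process P M -> (forall k, measurable (B k)) ->
  (forall k, lebesgue2 (B k) = (v k)%:E) ->
  (forall k k', size k != size k' -> B k `&` B k' = set0) ->
  (forall om k, exists j : nat, M om (B k) = j%:R%:E) ->
  (P (counts_cell B M (rcons k m)) =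
   P (counts_cell B M k) * (poisson_weight (v k) m)%:E)%E.
Proof.
move=> [_ PB Pind] mB Bv Bdisj Mnat.
have cellE l : (P (counts_cell B M l) = \prod_(i < size l)
    P [set om | M om (B (take i l)) = (nth 0%N l i)%:R%:E])%E.
  rewrite counts_cell_bigcap//.
  apply: (Pind (size l) (fun i => B (take i l)) (fun i => nth 0%N l i)) => //.
  apply/trivIsetP => i j _ _ ij; apply: Bdisj.
  by rewrite !size_takel// ltnW.
rewrite !cellE size_rcons big_ord_recr /=; congr (_ * _)%E.
  apply: eq_bigr => i _; congr (P _); apply/funext => om /=.
  by rewrite -cats1 takel_cat ?(ltnW (ltn_ord i))// nth_cat ltn_ord.
rewrite -cats1 take_size_cat// nth_cat ltnn subnn /=.
by rewrite PB// Bv ?ltry.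
Qed.

Section lyapunov.
Context {R : realType}.
Implicit Types (k : seq nat) (x : R).

(** The exponential-kernel sum on the grid: with [rho = expR (- a * delta)], each new window
    multiplies the past by [rho], and the last count has weight 1. *)
Definition discounted_sum (rho : R) (k : seq nat) : R :=
  foldl (fun x m => rho * x + m%:R) 0 k.

Lemma discounted_sum_rcons rho k m :
  discounted_sum rho (rcons k m) = rho * discounted_sum rho k + m%:R.
Proof. by rewrite /discounted_sum foldl_rcons. Qed.

Lemma discounted_sumE rho k : discounted_sum rho k =
  \sum_(i < size k) rho ^+ ((size k).-1 - i) * (nth 0%N k i)%:R.
Proof.
elim/last_ind: k => [|k m IH]; first by rewrite big_ord0.
rewrite discounted_sum_rcons IH size_rcons big_ord_recr /= subnn mul1r.
rewrite nth_rcons ltnn eqxx mulr_sumr; congr (_ + _).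
apply: eq_bigr => -[i ik] _ /=; rewrite nth_rcons ik mulrA -exprS; congr (_ ^+ _ * _).
by move: ik; case: (size k) => // s; rewrite ltnS => si; rewrite subSn.
Qed.

Lemma discounted_sum_ge0 rho k : 0 <= rho -> 0 <= discounted_sum rho k.
Proof. by move=> r0; rewrite discounted_sumE sumr_ge0// => i _; rewrite mulr_ge0 ?exprn_ge0. Qed.

(* An exponential Lyapunov function of the two discounted sums: the compensator
   of the last count is absorbed by the decay of the coefficients. *)
Definition lyapunov (r rho K L c : R) (J : nat) (k : seq nat) : R :=
  let g := c * r ^+ (J - size k) in
  expR (g * (discounted_sum r k + K * discounted_sum rho k) + L * (c - g)).

(** The Poisson moment contributes [v * (expR y - 1)], at most [(1 + tau) * v * y], with
    [y = g * (1 + K)]. Its part proportional to [x] is paid by [g * K * (r - rho) * x], and its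
    constant part by the growth [L * g * (1 - r)] of the second term. *)
Lemma lyapunov_step (e b delta tau r rho K L c D : R) (J : nat) k :
  0 <= e -> 0 <= b -> 0 <= delta -> 0 <= tau -> 0 <= r <= 1 -> 0 <= rho ->
  0 <= K -> 0 <= L -> 0 <= c -> 0 <= D ->
  (forall y, 0 <= y <= c * (1 + K) -> expR y - 1 <= (1 + tau) * y) ->
  delta * b * (1 + tau) * (1 + K) <= K * (r - rho) ->
  delta * e * (1 + tau) * (1 + K) <= L * (1 - r) ->
  (size k < J)%N ->
  (\sum_(0 <= m <oo) (poisson_weight (delta * (e + b * discounted_sum rho k)) m *
      (D * lyapunov r rho K L c J (rcons k m)))%:E <=
    (D * lyapunov r rho K L c J k)%:E)%E.
Proof.
move=> e0 b0 de0 tau0 /andP[r0 r1] rho0 K0 L0 c0 D0 exp_le H1 H2 kJ.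
set x := discounted_sum rho k; set s := discounted_sum r k.
have x0 : 0 <= x by exact: discounted_sum_ge0.
set v := delta * _; have v0 : 0 <= v.
  by rewrite /v mulr_ge0// addr_ge0// mulr_ge0.
pose g := c * r ^+ (J - (size k).+1); pose y := g * (1 + K).
have g0 : 0 <= g by rewrite mulr_ge0 ?exprn_ge0.
have gc : g <= c by rewrite ler_piMr// exprn_ile1.
pose A := g * (r * s + K * (rho * x)) + L * (c - g).
have stepE m : lyapunov r rho K L c J (rcons k m) = expR A * expR (y * m%:R).
  rewrite /lyapunov size_rcons -/g !discounted_sum_rcons -expRD; congr expR.
  by rewrite /A /y -/x -/s; ring.
have -> : (\sum_(0 <= m <oo) (poisson_weight v m *
      (D * lyapunov r rho K L c J (rcons k m)))%:E =
    (D * expR A * expR (v * (expR y - 1)))%:E)%E.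
  rewrite EFinM -poisson_exponential_moment// -nneseriesZl; last first.
    by move=> m _; rewrite lee_fin mulr_ge0 ?expR_ge0// poisson_weight_ge0.
  by apply: eq_eseriesr => m _; rewrite stepE -EFinM; congr EFin; ring.
rewrite lee_fin -mulrA -expRD ler_wpM2l// ler_expR.
(* Since [size k < J], the truncated subtraction is exact: one window earlier the coefficient is
   [r * g]. *)
have gE : c * r ^+ (J - size k) = r * g by rewrite -subSS subSn// exprS /g; ring.
rewrite gE -/x -/s.
have : v * (expR y - 1) <= v * ((1 + tau) * y).
  rewrite ler_wpM2l// exp_le// /y mulr_ge0 ?addr_ge0//=.
  by rewrite ler_wpM2r// addr_ge0.
rewrite -subr_ge0 => P1.
(* [P1] is the linearisation of the exponential, [P2] the part in [x], [P3] the constant part; they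
   add up exactly to the required difference of exponents. *)
have P2 : 0 <= g * (x * (K * (r - rho) - delta * b * (1 + tau) * (1 + K))).
  by apply: mulr_ge0 => //; apply: mulr_ge0 => //; rewrite subr_ge0.
have P3 : 0 <= g * (L * (1 - r) - delta * e * (1 + tau) * (1 + K)).
  by apply: mulr_ge0 => //; rewrite subr_ge0.
rewrite -subr_ge0; move: (addr_ge0 (addr_ge0 P1 P2) P3).
rewrite [in X in _ -> X]/A /y /v -/x; congr (is_true (0 <= _)); ring.
Qed.

(** This keeps the order 4 term of the exponential series, with [4! = 24]. *)
Lemma exp4_le (c s : R) : 0 < c -> 0 <= s ->
  s ^+ 4 <= 24 / c ^+ 4 * expR (c * s).
Proof.
move=> c0 s0; have := @expR_ge1Dxn R (c * s) 3 (mulr_ge0 (ltW c0) s0).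
rewrite (_ : 4`!%:R = 24 :> R)// => H.
rewrite mulrAC ler_pdivlMr ?exprn_gt0//.
have : (c * s) ^+ 4 / 24 <= expR (c * s) by apply: le_trans H; rewrite lerDr.
by rewrite exprMn; lra.
Qed.

(** To first order in [delta], and after division by [a], the first inequality follows from [th * (1
    + tau) * (1 + K) <= K * (1 + th) / 2]. As [(1 + th) / 2 - th = v], it suffices that [K * v] beat
    [th] and corrections of size [tau]; [K = 4 / v] does so. The value of [L] is read off the second
    inequality. *)
Lemma stability_constants (e th a beta : R) :
  0 <= e -> 0 < th < 1 -> 0 < a -> 0 < beta <= a * (1 - th) / 2 ->
  exists (delta0 tau K L c : R),
  [/\ 0 < delta0, 0 <= tau, 0 <= K, 0 <= L & 0 < c] /\
  (forall y, 0 <= y <= c * (1 + K) -> expR y - 1 <= (1 + tau) * y) /\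
  forall delta, 0 <= delta <= delta0 ->
    delta * (th * a) * (1 + tau) * (1 + K) <=
      K * (expR (- beta * delta) - expR (- a * delta)) /\
    delta * e * (1 + tau) * (1 + K) <= L * (1 - expR (- beta * delta)).
Proof.
move=> e0 /andP[th0 th1] a0 /andP[b0 ba].
pose v := (1 - th) / 2; have v0 : 0 < v by rewrite /v; lra.
have v1 : v < 1 by rewrite /v; lra.
pose tau := v / 4; have tau0 : 0 < tau by rewrite /tau; lra.
pose K := 4 / v; have K0 : 0 < K by rewrite divr_gt0.
have Kv : K * v = 4 by rewrite /K mulfVK// gt_eqF.
pose L := 2 * e * (1 + tau) * (1 + K) / beta.
(* These choices ensure [a * delta <= tau] and [c * (1 + K) = tau / 2]. *)
exists (tau / a), tau, K, L, (tau / 2 / (1 + K)).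
split; first split.
- exact: divr_gt0.
- exact: ltW.
- exact: ltW.
- by rewrite /L divr_ge0// ?(ltW b0)// !mulr_ge0// addr_ge0// ltW.
- by apply: divr_gt0; [exact: divr_gt0|exact: addr_gt0].
split=> [y|delta /andP[de0 de1]].
  rewrite mulfVK ?gt_eqF ?addr_gt0// => /andP[y0 y1].
  have tau1 : tau < 1 by rewrite /tau; lra.
  (* After multiplication by [1 - y], the claim reduces to [y * (1 + tau) <= tau], which holds since
     [y <= tau / 2] and [tau < 1]. *)
  have : (1 - y) * expR y <= 1.
    rewrite -ler_pdivlMr ?expR_gt0// div1r -expRN.
    exact: expR_ge1Dx.
  have := expR_gt0 y; have := expR_ge1Dx y.
  set E := expR y => E1 E2 E3.
  suff : E <= 1 + (1 + tau) * y by lra.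
  rewrite -(@ler_pM2l _ (1 - y)); last by lra.
  rewrite (le_trans E3)//.
  have : 0 <= y * (tau - y * (1 + tau)) by rewrite mulr_ge0// ; nra.
  lra.
have ad : a * delta <= tau by rewrite mulrC -ler_pdivlMr.
have ad0 : 0 <= a * delta by rewrite mulr_ge0// ltW.
have bd : beta * delta <= a * delta by rewrite ler_wpM2r//; nra.
have tau1 : tau < 1 by rewrite /tau; lra.
have EaE : 1 - tau <= expR (- a * delta).
  by rewrite (le_trans _ (expR_ge1Dx _))// mulNr; lra.
(* Factoring out [expR (- a * delta)] bounds the difference of exponentials below by
   [(1 - tau) * (a - beta) * delta]. *)
have EbE : expR (- beta * delta) = expR (- a * delta) * expR ((a - beta) * delta).
  by rewrite -expRD; congr expR; ring.
have E1 := expR_ge1Dx ((a - beta) * delta).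
have Ea0 := expR_gt0 (- a * delta).
split.
  rewrite EbE; set Ea := expR (- a * delta) in EaE Ea0 *.
  set Ed := expR _ in E1 *.
  have : Ea * ((a - beta) * delta) <= Ea * (Ed - 1) by rewrite ler_wpM2l ?(ltW Ea0)//; lra.
  have abd : a * (1 + th) / 2 * delta <= (a - beta) * delta.
    by rewrite ler_wpM2r//; lra.
  have : (1 - tau) * (a * (1 + th) / 2 * delta) <= Ea * ((a - beta) * delta).
    rewrite ler_pM//; first by lra.
    by rewrite !mulr_ge0// ?(ltW a0)//; lra.
  move=> H1 H2; have H3 := le_trans H1 H2.
  rewrite mulrBr -mulrBr -[X in _ - X]mulr1 -mulrBr.
  apply: le_trans (ler_wpM2l (ltW K0) H3).
  rewrite -subr_ge0.
  have -> : K * ((1 - tau) * (a * (1 + th) / 2 * delta)) -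
     delta * (th * a) * (1 + tau) * (1 + K) =
     (a * delta) * (K * ((1 - tau) * (1 + th) / 2 - th * (1 + tau)) - th * (1 + tau)).
    by field.
  rewrite mulr_ge0//.
  have -> : (1 - tau) * (1 + th) / 2 - th * (1 + tau) =
    v * (1 - (1 + 3 * th) / 8).
    by rewrite /tau /v; field.
  rewrite mulrA Kv; nra.
(* For [0 <= z <= 1], [expR (- z) <= 1 / (1 + z)] gives [1 - expR (- z) >= z / 2]. *)
have Eb : 1 - expR (- beta * delta) >= beta * delta / 2.
  have := expR_ge1Dx (beta * delta).
  have : expR (beta * delta) * expR (- beta * delta) = 1.
    by rewrite -expRD -mulrDl subrr mul0r expR0.
  have : expR (- beta * delta) <= 1.
    by rewrite -expR0 ler_expR mulNr oppr_le0 mulr_ge0// ltW.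
  have := expR_gt0 (- beta * delta).
  set E := expR (- beta * delta); set E' := expR (beta * delta).
  have : 0 <= beta * delta by rewrite mulr_ge0// ltW.
  set z := beta * delta in bd *.
  have : z <= 1 by lra.
  nra.
apply: le_trans (ler_wpM2l _ Eb).
  rewrite le_eqVlt; apply/orP; left; apply/eqP; rewrite /L; field.
  by rewrite gt_eqF.
by rewrite /L divr_ge0// ?(ltW b0)// !mulr_ge0// addr_ge0// ltW.
Qed.

End lyapunov.

(** * Marks independent of a point process *)

Section kernel_integral.
Import HBNNSimple.

(** A point process is finite on a bounded set for each outcome, with no uniform bound. The measure
    is therefore restricted to [D], the integrand extended by 0, and simple functions do the
    rest. *)
Lemma measurable_fun_integral_kernel_restr d d' (X : measurableType d)
    (Y : measurableType d') (R : realType) (k : R.-ker X ~> Y) (D : set Y)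
    (g : X * Y -> \bar R) :
  measurable D -> (forall x, k x D < +oo)%E ->
  measurable_fun setT g -> (forall z, 0 <= g z)%E ->
  measurable_fun setT (fun x => \int[k x]_(y in D) g (x, y))%E.
Proof.
move=> mD kD mg g0.
pose gD (z : X * Y) := (g \_ (setT `*` D)) z.
have mgD : measurable_fun setT gD.
  apply/(measurable_restrictT _ _).1; first exact: measurableX.
  exact: measurable_funTS.
have -> : (fun x => \int[k x]_(y in D) g (x, y))%E =
    (fun x => \int[mrestr (k x) mD]_y gD (x, y))%E.
  apply/funext => x.
  rewrite (eq_measure_integral (mrestr (k x) mD)); last first.
    by move=> A mA AD; congr (k x _); apply/esym/setIidl.
  rewrite integral_mkcond; apply: eq_integral => y _.
  by rewrite /gD /patch in_setX in_setT.
pose k_ := nnsfun_approx measurableT mgD.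
apply: (measurable_fun_xsection_integral gD _ k_).
- by move=> a b ab; exact/nd_nnsfun_approx.
- move=> z; apply: cvg_nnsfun_approx => //.
  by move=> {}z _; rewrite /gD /patch; case: ifP.
- move=> n r.
  have mk : measurable (k_ n @^-1` [set r]) by exact: measurable_funPTI.
  have [] := @measurable_prod_subset_xsection_kernel _ _ _ _ _ k D mD _ _ mk => //.
  move=> x; exists (fine (k x D) + 1) => B mB.
  rewrite (@le_lt_trans _ _ (k x D))//.
    by apply: le_measure; rewrite ?inE//; exact: measurableI.
  by rewrite EFinD fineK ?ge0_fin_numE// lteDl ?ge0_fin_numE.
Qed.

End kernel_integral.

(** Independence identifies the joint law with the product of the marginal laws; Tonelli's theorem
    concludes. *)
Lemma integral_independent d d1 d2 (T : measurableType d)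
    (T1 : measurableType d1) (T2 : measurableType d2) (R : realType)
    (P : probability T R) (X1 : {mfun T >-> T1}) (X2 : {mfun T >-> T2})
    (g : T1 * T2 -> \bar R) :
  (forall A1 A2, measurable A1 -> measurable A2 ->
    P (X1 @^-1` A1 `&` X2 @^-1` A2) = P (X1 @^-1` A1) * P (X2 @^-1` A2))%E ->
  measurable_fun setT g -> (forall z, 0 <= g z)%E ->
  (\int[P]_x g (X1 x, X2 x) = \int[P]_x2 \int[P]_x1 g (X1 x1, X2 x2))%E.
Proof.
move=> ind mg g0.
have m12 : measurable_fun setT (fun x => (X1 x, X2 x)) by exact: measurable_fun_pair.
have mgx x2 : measurable_fun setT (fun x1 => g (x1, x2)).
  by apply: measurableT_comp => //; exact: measurable_fun_pair.
transitivity (\int[pushforward P (fun x => (X1 x, X2 x))]_z g z)%E.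
  by rewrite ge0_integral_pushforward// preimage_setT.
transitivity (\int[distribution P X1 \x distribution P X2]_z g z)%E.
  apply: eq_measure_integral => A mA _; apply/esym.
  by apply: product_measure_unique => // A1 A2 m1 m2; rewrite /= -ind.
rewrite (fubini_tonelli2 g mg g0) /distribution ge0_integral_pushforward//; last 2 first.
- exact: measurable_fun_fubini_tonelli_G.
- by move=> x _; apply: integral_ge0.
rewrite preimage_setT; apply: eq_integral => x2 _ /=.
by rewrite /fubini_G ge0_integral_pushforward// preimage_setT.
Qed.

Section mark_average.
Context {R : realType} {dO : measure_display} {Omega : measurableType dO}.
Variable P : probability Omega R.
Context {dT dY : measure_display} {T : measurableType dT} {Y : measurableType dY}.
Local Notation mR := (measurableTypeR R).

Definition event_generators (M : R.-ker Omega ~> T) : set (set Omega) :=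
  [set E | exists (B : set T) (C : set (\bar R)),
     [/\ measurable B, measurable C & E = [set omega | C (M omega B)]]].

(** The same measures, with [Omega] carrying only the sigma-algebra generated by [M]: integrals
    against it are then functions to which independence from the marks applies. *)
Definition coarse_kernel (M : R.-ker Omega ~> T) :
  g_sigma_algebraType (event_generators M) -> {measure set T -> \bar R} := M.

Arguments coarse_kernel : clear implicits.

Lemma measurable_coarse_kernel (M : R.-ker Omega ~> T) U :
  measurable U -> measurable_fun setT (coarse_kernel M ^~ U).
Proof.
move=> mU _ C mC; rewrite setTI; apply: sub_sigma_algebra.
by exists U, C.
Qed.

HB.instance Definition _ (M : R.-ker Omega ~> T) :=
  isKernel.Build _ _ _ _ R (coarse_kernel M) (@measurable_coarse_kernel M).

Lemma measure_events_measurable (M : R.-ker Omega ~> T) :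
  measure_events M `<=` measurable.
Proof.
apply: smallest_sub; first exact: sigma_algebra_measurable.
move=> _ [B [C [mB mC ->]]]; rewrite -[X in measurable X]setTI.
exact: (measurable_kernel M _ mB measurableT _ mC).
Qed.

Lemma path_events_measurable (y : R -> Omega -> Y) :
  (forall t, measurable_fun setT (y t)) -> path_events y `<=` measurable.
Proof.
move=> my _ [C + ->]; move: C; apply: smallest_sub.
  split=> [|C mC|C mC] /=.
  - by rewrite (_ : [set _ | _] = set0) ?measurable0//; apply/seteqP; split.
  - rewrite (_ : [set _ | _] = ~` [set om | C (y ^~ om)]); last first.
      by apply/seteqP; split=> om //= [].
    exact: measurableC.
  - rewrite (_ : [set _ | _] = \bigcup_k [set om | C k (y ^~ om)]); last first.
      by apply/seteqP; split=> om [k _ Ck]; exists k.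
    exact: bigcup_measurable.
move=> _ [t [A [mA ->]]] /=; rewrite -[X in measurable X]setTI.
exact: my.
Qed.

(** Preimages of a sigma-algebra under one map already form a sigma-algebra. *)
Lemma sigma_path_events (y : R -> Omega -> Y) :
  <<s path_events y>> = path_events y.
Proof.
apply: sigma_algebra_id; have := sigma_algebra_preimage setT
  (fun om : Omega => (y ^~ om)) (smallest_sigma_algebra setT
   [set C : set (R -> Y) | exists (t : R) (A : set Y),
         measurable A /\ C = [set x | A (x t)]]).
congr (sigma_algebra _ _); apply/seteqP; split=> E [C mC].
  by rewrite setTI => <-; exists C.
by move=> ->; exists C => //; rewrite setTI.
Qed.

Lemma measurable_path_id (y : R -> Omega -> Y) :
  (forall t, measurable_fun setT (y t)) ->
  measurable_fun setT (id : Omega -> g_sigma_algebraType (path_events y)).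
Proof.
move=> my _ E; rewrite setTI /measurable /= sigma_path_events.
exact: path_events_measurable.
Qed.

Lemma measurable_marks (dU : measure_display) (U : measurableType dU)
    (y : R -> Omega -> Y) (phi : Y -> \bar R) (u1 : U -> mR) (u2 : U -> Omega) :
  measurable_fun setT
    (fun z : (mR * g_sigma_algebraType (path_events y))%type => phi (y z.1 z.2)) ->
  measurable_fun setT u1 ->
  measurable_fun setT (u2 : U -> g_sigma_algebraType (path_events y)) ->
  measurable_fun setT (fun u => phi (y (u1 u) (u2 u))).
Proof.
move=> mphi mu1 mu2; exact: (measurableT_comp mphi (measurable_fun_pair mu1 mu2)).
Qed.

Lemma measurable_integral_marks (M : R.-ker Omega ~> T) (y : R -> Omega -> Y)
    (tm : T -> mR) (phi : Y -> \bar R) (D : set T) :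
  (forall t, measurable_fun setT (y t)) ->
  measurable_fun setT
    (fun z : (mR * g_sigma_algebraType (path_events y))%type => phi (y z.1 z.2)) ->
  (forall t om, 0 <= phi (y t om))%E ->
  measurable_fun setT tm -> measurable D -> (forall om, M om D < +oo)%E ->
  measurable_fun setT (fun om => \int[M om]_(z in D) phi (y (tm z) om))%E.
Proof.
move=> my mphi phi0 mtm mD MD.
apply: (@measurable_fun_integral_kernel_restr _ _ _ _ _ M D
  (fun u : Omega * T => phi (y (tm u.2) u.1))) => //.
apply: (@measurable_marks _ _ y phi (fun u : Omega * T => tm u.2) fst mphi).
  exact: (measurableT_comp mtm measurable_snd).
exact: (measurableT_comp (measurable_path_id my) measurable_fst).
Qed.

(** The first coordinate is ignored by the kernel and left free to carry an independent copy of the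
    marks. *)
Definition snd_coarse_kernel (dX : measure_display) (X : measurableType dX)
    (M : R.-ker Omega ~> T)
    (z : X * g_sigma_algebraType (event_generators M)) :
  {measure set T -> \bar R} := coarse_kernel M z.2.
Arguments snd_coarse_kernel {dX} X M.

Lemma measurable_snd_coarse_kernel (dX : measure_display) (X : measurableType dX)
    (M : R.-ker Omega ~> T) U :
  measurable U -> measurable_fun setT (snd_coarse_kernel X M ^~ U).
Proof.
move=> mU; apply: (measurableT_comp (measurable_coarse_kernel mU)).
exact: measurable_snd.
Qed.

HB.instance Definition _ (dX : measure_display) (X : measurableType dX)
    (M : R.-ker Omega ~> T) :=
  isKernel.Build _ _ _ _ R (snd_coarse_kernel X M)
    (@measurable_snd_coarse_kernel _ X M).

(** Independence allows the marks and [M] to be read at two separate outcomes [om1] and [om2]. With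
    [om2] frozen, Tonelli's theorem averages the mark at each fixed time first, which gives [c]. *)
Lemma integral_independent_marks (M : R.-ker Omega ~> T) (y : R -> Omega -> Y)
    (tm : T -> mR) (phi : Y -> \bar R) (c : \bar R) (A : set Omega) (D : set T) :
  (forall t, measurable_fun setT (y t)) ->
  independent_events P (path_events y) (measure_events M) ->
  measurable_fun setT
    (fun z : (mR * g_sigma_algebraType (path_events y))%type => phi (y z.1 z.2)) ->
  (forall t om, 0 <= phi (y t om))%E ->
  (forall t, \int[P]_om phi (y t om) = c)%E ->
  measurable_fun setT tm -> measure_events M A -> measurable D ->
  (forall om, M om D < +oo)%E ->
  (\int[P]_(om in A) \int[M om]_(z in D) phi (y (tm z) om) =
   c * \int[P]_(om in A) M om D)%E.
Proof.
move=> my ind mphi phi0 phic mtm eA mD MD.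
have mA : measurable A by exact: measure_events_measurable eA.
pose Oy := g_sigma_algebraType (path_events y).
pose On := g_sigma_algebraType (event_generators M).
have mX1 : measurable_fun setT (id : Omega -> Oy) by exact: measurable_path_id.
have mX2 : measurable_fun setT (id : Omega -> On).
  by move=> _ E mE; rewrite setTI; exact: (measure_events_measurable mE).
(* Two identity maps, into [Omega] with the sigma-algebra of the marks and with that of [M]: their
   independence as random variables is that of the sigma-algebras. *)
pose X1 : {mfun Omega >-> Oy} := HB.pack (id : Omega -> Oy)
  (isMeasurableFun.Build _ _ _ _ _ mX1).
pose X2 : {mfun Omega >-> On} := HB.pack (id : Omega -> On)
  (isMeasurableFun.Build _ _ _ _ _ mX2).
pose g (p : Oy * On) : \bar R :=
  (\int[snd_coarse_kernel Oy M p]_(z in D) phi (y (tm z) p.1))%E.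
have mg : measurable_fun setT g.
  apply: (@measurable_fun_integral_kernel_restr _ _ _ _ _ _ D
    (fun u : (Oy * On) * T => phi (y (tm u.2) u.1.1))) => //.
    move=> x; exact: MD.
  apply: (@measurable_marks _ _ y phi (fun u : (Oy * On) * T => tm u.2)
    (fun u => u.1.1) mphi).
    exact: (measurableT_comp mtm measurable_snd).
  exact: (measurableT_comp measurable_fst measurable_fst).
have g0 p : (0 <= g p)%E by apply: integral_ge0.
pose gA := g \_ (setT `*` (A : set On)).
have mAn : measurable (A : set On) by exact: eA.
have mgA : measurable_fun setT gA.
  apply/(measurable_restrictT _ _).1; first exact: measurableX.
  exact: measurable_funTS.
have gA0 p : (0 <= gA p)%E by rewrite /gA /patch; case: ifP.
have gAE om1 om2 : gA (om1, om2) = ((fun om2 => g (om1, om2)) \_ A) om2.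
  by rewrite /gA /patch in_setX in_setT.
transitivity (\int[P]_om gA (X1 om, X2 om))%E.
  rewrite integral_mkcond; apply: eq_integral => om _ /=.
  by rewrite gAE.
rewrite integral_independent//; last first.
  move=> A1 A2 m1 m2; rewrite /= !preimage_id; apply: ind => //.
  by rewrite -sigma_path_events.
have c0 : (0 <= c)%E by rewrite -(phic 0); exact: integral_ge0.
rewrite -ge0_integralZl//; last exact: measurable_funTS (measurable_kernel M _ mD).
rewrite [RHS]integral_mkcond; apply: eq_integral => om2 _ /=.
under eq_integral do rewrite gAE.
rewrite /patch; case: ifPn => _; last by rewrite integral0.
pose F (p : Omega * T) := ((fun p : Omega * T => phi (y (tm p.2) p.1)) \_ (setT `*` D)) p.
have mF : measurable_fun setT F.
  apply/(measurable_restrictT _ _).1; first exact: measurableX.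
  apply: measurable_funTS.
  apply: (@measurable_marks _ _ y phi (fun u : Omega * T => tm u.2) fst mphi).
    exact: (measurableT_comp mtm measurable_snd).
  exact: (measurableT_comp mX1 measurable_fst).
have F0 p : (0 <= F p)%E by rewrite /F /patch; case: ifP.
have FE om z : F (om, z) = ((fun z => phi (y (tm z) om)) \_ D) z.
  by rewrite /F /patch in_setX in_setT.
pose m2 : {finite_measure set T -> \bar R} := mfrestr mD (MD om2).
have m2E f : (\int[M om2]_(z in D) f z = \int[m2]_(z in D) f z)%E.
  by apply: eq_measure_integral => B mB BD; congr (M om2 _); apply/esym/setIidl.
transitivity (\int[P]_om \int[m2]_z F (om, z))%E.
  apply: eq_integral => om _; rewrite /g m2E integral_mkcond.
  by apply: eq_integral => z _; rewrite FE.
rewrite (fubini_tonelli F mF F0).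
transitivity (\int[m2]_(z in D) c)%E.
  rewrite [RHS]integral_mkcond; apply: eq_integral => z _.
  under eq_integral do rewrite FE.
  rewrite /patch; case: ifP => _; first exact: phic.
  by rewrite integral0.
rewrite integral_cst//; congr (_ * M om2 _)%E; exact: setIid.
Qed.

End mark_average.
Arguments coarse_kernel {R dO Omega dT T} M om.

(** * Fourth moment of the score under the law of the marks *)

Section density.
Import HBNNSimple.

(** Linearity for simple functions, then monotone convergence. *)
Lemma ge0_integral_density d (T : measurableType d) (R : realType)
    (mu nu : {measure set T -> \bar R}) (D : set T) (f : T -> R)
    (g : T -> \bar R) :
  measurable D -> measurable_fun D f -> (forall x, D x -> 0 <= f x) ->
  (forall A, measurable A -> A `<=` D -> nu A = \int[mu]_(x in A) (f x)%:E)%E ->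
  measurable_fun D g -> (forall x, D x -> 0 <= g x)%E ->
  (\int[nu]_(x in D) g x = \int[mu]_(x in D) (g x * (f x)%:E))%E.
Proof.
move=> mD mf f0 nuE mg g0.
have mEf : measurable_fun D (fun x => (f x)%:E) by exact/measurable_EFinP.
pose phi := nnsfun_approx mD mg.
have mphi n : measurable_fun D (fun x => (phi n x)%:E).
  exact/measurable_EFinP/measurable_funTS.
have nd n m x : (n <= m)%N -> phi n x <= phi m x.
  by move=> nm; have /lefP := nd_nnsfun_approx mD mg nm; exact.
have cvgphi x : D x -> (phi n x)%:E @[n --> \oo] --> g x.
  by move=> Dx; exact: cvg_nnsfun_approx.
have simple n : (\int[nu]_(x in D) (phi n x)%:E =
    \int[mu]_(x in D) ((phi n x)%:E * (f x)%:E))%E.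
  have mpre r : measurable (phi n @^-1` [set r]) by exact: measurable_funPTI.
  transitivity (\int[nu]_(x in D) \sum_(r \in range (phi n))
      (r * \1_(phi n @^-1` [set r]) x)%:E)%E.
    by apply: eq_integral => x _; rewrite fsumEFin// -fimfunE.
  rewrite ge0_integral_fsum//; last 2 first.
  - by move=> r; apply/measurable_EFinP/measurable_funTS/measurable_funM.
  - by move=> r x _; exact: nnfun_muleindic_ge0.
  transitivity (\int[mu]_(x in D) \sum_(r \in range (phi n))
      ((r * \1_(phi n @^-1` [set r]) x)%:E * (f x)%:E))%E; last first.
    apply: eq_integral => x /set_mem Dx; rewrite -ge0_mule_fsuml//.
      by rewrite fsumEFin// -fimfunE.
    by move=> r; exact: nnfun_muleindic_ge0.
  rewrite ge0_integral_fsum//; last 2 first.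
  - move=> r; apply: emeasurable_funM => //.
    by apply/measurable_EFinP/measurable_funTS/measurable_funM.
  - move=> r x Dx; rewrite mule_ge0 ?lee_fin ?f0//.
    exact: (nnfun_muleindic_ge0 (phi n) r x).
  apply: eq_fsbigr => r /set_mem [x _ rE].
  have r0 : 0 <= r by rewrite -rE.
  under eq_integral do rewrite EFinM.
  rewrite ge0_integralZl//; last exact/measurable_EFinP/measurable_funTS.
  rewrite integral_indic// nuE; [|exact: measurableI|exact: subIsetr].
  rewrite [RHS](_ : _ = \int[mu]_(x in D) (r%:E *
      ((\1_(phi n @^-1` [set r]) x)%:E * (f x)%:E)))%E; last first.
    by apply: eq_integral => z _; rewrite EFinM muleA.
  rewrite ge0_integralZl//; last 2 first.
  - apply: emeasurable_funM => //.
    exact/measurable_EFinP/measurable_funTS.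
  - by move=> z Dz; rewrite mule_ge0 ?lee_fin ?f0.
  congr (_ * _)%E; rewrite setIC integral_mkcondr.
  apply: eq_integral => z _; rewrite /patch indicE.
  by case: ifP => _; rewrite ?mul1e ?mul0e.
transitivity (limn (fun n => \int[nu]_(x in D) (phi n x)%:E))%E.
  rewrite -monotone_convergence//.
  - by apply: eq_integral => x /set_mem Dx; apply/esym/cvg_lim => //; exact: cvgphi.
  - by move=> n x _; rewrite lee_fin.
  - by move=> x _ n m nm; rewrite lee_fin nd.
transitivity (limn (fun n => \int[mu]_(x in D) ((phi n x)%:E * (f x)%:E)))%E.
  by congr (limn _); apply/funext => n; exact: simple.
rewrite -monotone_convergence//.
- apply: eq_integral => x /set_mem Dx; apply/cvg_lim => //.
  by under eq_cvg do rewrite muleC; rewrite muleC; apply: cvgeZl => //; exact: cvgphi.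
- by move=> n; exact: emeasurable_funM.
- by move=> n x Dx; rewrite mule_ge0 ?lee_fin ?f0.
- by move=> x Dx n m nm; rewrite lee_wpmul2r ?lee_fin ?f0 ?nd.
Qed.
End density.

Section score.
Context {R : realType} {d q r : nat}.
Local Notation mR := (measurableTypeR R).
Local Notation mark := (d.-tuple mR).

(** Each partial derivative of [h] at 0 is a pointwise limit of difference quotients of steps
    [1 / (n + 1)], and the sup norm is a finite maximum. *)
Lemma measurable_scoreG_norm (X : set mark) (f : mark -> 'rV[R]_q -> R)
    (h : mark -> 'rV[R]_r -> R) (Phi : set 'rV[R]_q) (Psi : set 'rV[R]_r)
    (phi : 'rV[R]_q) :
  measurable X -> Psi 0 -> boost_conditions X f h Phi Psi phi ->
  measurable_fun X (fun x => `|scoreG X f h phi x|).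
Proof.
move=> mX Psi0 bc.
have mG l : measurable_fun X (fun x => scoreG X f h phi x 0 l).
  have -> : (fun x => scoreG X f h phi x 0 l) = (fun x => 'D_(unitv l) (h x) 0 -
      expect X f phi (fun x => scoreH h x 0 l)).
    by apply/funext => x; rewrite /scoreG /scoreH !mxE.
  apply: measurable_funB => //.
  apply: (@measurable_fun_cvg _ _ _ _ (fun n x =>
    (n.+1%:R^-1)^-1 *: (h x (n.+1%:R^-1 *: unitv l + 0) - h x 0))).
    move=> n; apply: measurable_funM => //.
    by apply: measurable_funB; exact: h_measurable bc _.
  move=> x Xx; have dh : derivable (h x) 0 (unitv l) by exact: (h_derivable bc).
  apply: ((cvgr_dnbhsP _ _ _).1 dh); split; last exact: cvg_harmonic.
  by move=> n; rewrite invr_eq0.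
have -> : (fun x => `|scoreG X f h phi x|) =
    (fun x => \big[Num.max/0]_(l : 'I_1 * 'I_r) `|scoreG X f h phi x 0 l.2|).
  apply/funext => x; rewrite [LHS]/Num.norm /= mx_normrE.
  by apply: eq_bigr => -[i l] _ /=; rewrite (ord1 i).
elim: (index_enum _) => [|l s IH].
  by under eq_fun do rewrite big_nil; exact: measurable_cst.
under eq_fun do rewrite big_cons.
by apply: measurable_maxr => //; exact: measurableT_comp.
Qed.

(** All [y t] have the law of density [f] at [phi] on [X], so one constant serves every [t]. *)
Lemma score_moment (dO : measure_display) (Omega : measurableType dO)
    (P : probability Omega R) (X : set mark) (f : mark -> 'rV[R]_q -> R)
    (h : mark -> 'rV[R]_r -> R) (Phi : set 'rV[R]_q) (Psi : set 'rV[R]_r)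
    (phi : 'rV[R]_q) (y : R -> Omega -> mark) :
  measurable X -> Phi phi -> Psi 0 -> density_family X f Phi ->
  boost_conditions X f h Phi Psi phi -> mark_process X f P y phi ->
  has_expect X f phi (fun x => `|scoreG X f h phi x| ^+ 4) ->
  exists2 c : R, 0 <= c & forall t,
    (\int[P]_om (`|scoreG X f h phi (y t om)| ^+ 4)%:E = c%:E)%E.
Proof.
move=> mX Phiphi Psi0 fd bc [[my _] _ _ Xy law] G4.
have mG := measurable_scoreG_norm mX Psi0 bc.
have [mf f0 _] := fd _ Phiphi.
have cE : (\int[lebesgue_tuple R d]_(x in X)
    ((`|scoreG X f h phi x| ^+ 4 * f x phi)%:E) \is a fin_num)%E.
  exact: integrable_fin_num.
exists (fine (\int[lebesgue_tuple R d]_(x in X)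
    ((`|scoreG X f h phi x| ^+ 4 * f x phi)%:E))%E).
  apply: fine_ge0; apply: integral_ge0 => x Xx.
  by rewrite lee_fin mulr_ge0 ?f0.
move=> t; rewrite fineK//.
pose g x := (`|scoreG X f h phi x| ^+ 4)%:E : \bar R.
have mg : measurable_fun X g.
  by apply/measurable_EFinP; exact: measurable_funX.
have yX : y t @^-1` X = setT by apply/seteqP; split=> // om _; exact: Xy.
transitivity (\int[pushforward P (y t)]_(x in X) g x)%E.
  rewrite ge0_integral_pushforward//; last by move=> x _; rewrite lee_fin.
  by rewrite yX.
rewrite (@ge0_integral_density _ _ _ (lebesgue_tuple R d) _ X (f ^~ phi))//.
  by move=> A mA AX; apply: etrans (law t A mA) _; rewrite setIidl.
by move=> x _; rewrite lee_fin.
Qed.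
End score.

(** * Pathwise domination of the Hawkes process *)

Lemma ge0_sume_le_inj (R : realType) (I : eqType) (L : seq I) (idx : I -> nat)
    (J : nat) (F : I -> \bar R) (G : nat -> \bar R) :
  uniq L -> {in L &, injective idx} -> (forall i, i \in L -> (idx i < J)%N) ->
  (forall j, 0 <= G j)%E -> (forall i, i \in L -> F i <= G (idx i))%E ->
  (\sum_(i <- L) F i <= \sum_(j < J) G j)%E.
Proof.
move=> uL idxI idxJ G0 FG.
apply: (@le_trans _ _ (\sum_(i <- L) G (idx i))%E).
  by rewrite big_seq [leRHS]big_seq; apply: lee_sum => i; exact: FG.
rewrite -(big_map idx xpredT G) -(big_mkord xpredT G) /index_iota subn0.
have uM : uniq (map idx L) by rewrite map_inj_in_uniq.
have sub : {subset map idx L <= iota 0 J}.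
  by move=> _ /mapP[i iL ->]; rewrite mem_iota add0n idxJ.
rewrite [leRHS](bigID (mem (map idx L))) /=.
rewrite -[leLHS]adde0; apply: leeD; last by apply: sume_ge0 => *; exact: G0.
rewrite -[leRHS]big_filter le_eqVlt; apply/orP; left; apply/eqP; apply: perm_big.
apply: uniq_perm => //; first by rewrite filter_uniq// iota_uniq.
move=> j; rewrite mem_filter; case: (boolP (j \in _)) => //= jL.
by rewrite sub.
Qed.

Lemma sumr_le_inj (R : realType) (I : eqType) (L : seq I) (idx : I -> nat)
    (J : nat) (F : I -> R) (G : nat -> R) :
  uniq L -> {in L &, injective idx} -> (forall i, i \in L -> (idx i < J)%N) ->
  (forall j, 0 <= G j) -> (forall i, i \in L -> F i <= G (idx i)) ->
  \sum_(i <- L) F i <= \sum_(j < J) G j.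
Proof.
move=> uL idxI idxJ G0 FG; rewrite -lee_fin -!sumEFin.
exact: (@ge0_sume_le_inj R I L idx J (EFin \o F) (EFin \o G)).
Qed.

Lemma sumr_cauchy_schwarz (R : realType) (I : eqType) (L : seq I) (w x : I -> R) :
  (forall i, i \in L -> 0 <= w i) ->
  (\sum_(i <- L) w i * x i) ^+ 2 <=
  (\sum_(i <- L) w i) * \sum_(i <- L) w i * x i ^+ 2.
Proof.
elim: L => [|i L IH] w0; first by rewrite !big_nil expr0n mul0r.
rewrite !big_cons.
have wi : 0 <= w i by rewrite w0 ?mem_head.
have w0' j : j \in L -> 0 <= w j by move=> jL; rewrite w0// inE jL orbT.
have W0 : 0 <= \sum_(j <- L) w j by rewrite big_seq sumr_ge0.
have Q0 : 0 <= \sum_(j <- L) w j * x j ^+ 2.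
  by rewrite big_seq sumr_ge0// => j jL; rewrite mulr_ge0 ?w0' ?sqr_ge0.
move: (IH w0') W0 Q0; set V := \sum_(_ <- _) _ * _.
set W := \sum_(_ <- _) w _; set Q := \sum_(_ <- _) _ => VWQ W0 Q0.
(* The cross term of the square: [V^2 <= W * Q] by induction, then the arithmetic-geometric
   inequality. *)
have key : 2 * (V * x i) <= W * x i ^+ 2 + Q.
  have [neg|pos] := leP (V * x i) 0.
    have : 0 <= W * x i ^+ 2 by rewrite mulr_ge0 ?sqr_ge0.
    lra.
  rewrite -(@ler_pXn2r _ 2)// ?nnegrE; [|lra|].
    have : (V * x i) ^+ 2 <= W * Q * x i ^+ 2.
      by rewrite exprMn ler_wpM2r ?sqr_ge0.
    have := sqr_ge0 (W * x i ^+ 2 - Q); nra.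
  by rewrite addr_ge0// mulr_ge0 ?sqr_ge0.
have : w i * (2 * (V * x i)) <= w i * (W * x i ^+ 2 + Q) by rewrite ler_wpM2l.
nra.
Qed.

(** Hoelder's inequality with exponents 4/3 and 4, obtained from Cauchy-Schwarz applied to [x] and
    then to its square. *)
Lemma sumr_power4_le (R : realType) (I : eqType) (L : seq I) (w x : I -> R) :
  (forall i, i \in L -> 0 <= w i) ->
  (\sum_(i <- L) w i * x i) ^+ 4 <=
  (\sum_(i <- L) w i) ^+ 3 * \sum_(i <- L) w i * x i ^+ 4.
Proof.
move=> w0; have W0 : 0 <= \sum_(j <- L) w j by rewrite big_seq sumr_ge0.
have H1 := sumr_cauchy_schwarz x w0.
have := sumr_cauchy_schwarz (fun i => x i ^+ 2) w0.
under [X in _ <= _ * X]eq_bigr do rewrite -exprM.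
move=> H2; rewrite (exprM _ 2 2).
apply: (@le_trans _ _ (((\sum_(i <- L) w i) * \sum_(i <- L) w i * x i ^+ 2) ^+ 2)).
  by rewrite ler_pXn2r// nnegrE ?sqr_ge0// (le_trans _ H1)// sqr_ge0.
by rewrite exprMn (exprSr _ 2) -mulrA ler_wpM2l ?sqr_ge0.
Qed.

Section windows.
Context {R : realType}.
Local Notation mR := (measurableTypeR R).
Variables (e th a delta : R).

(* Upper bound of the intensity on the window [size k * delta,
   (size k + 1) * delta[ when that window contains at most one event and the
   previous windows contain at most [k] events. *)
Definition window_rate (k : seq nat) : R :=
  e + th * a * discounted_sum (expR (- a * delta)) k.

Definition window_rect (k : seq nat) : set (mR * mR) :=
  [set` `[(size k)%:R * delta, (size k).+1%:R * delta[] `*`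
  [set` `[0, window_rate k]].

Hypotheses (e0 : 0 <= e) (th0 : 0 <= th) (a0 : 0 <= a) (delta0 : 0 <= delta).

Lemma window_rate_ge0 k : 0 <= window_rate k.
Proof. by rewrite addr_ge0// !mulr_ge0// discounted_sum_ge0// expR_ge0. Qed.

Lemma measurable_window_rect k : measurable (window_rect k).
Proof. by apply: measurableX; exact: measurable_itv. Qed.

Lemma lebesgue2_window_rect k :
  lebesgue2 (window_rect k) = (delta * window_rate k)%:E.
Proof.
rewrite /lebesgue2 /window_rect product_measure1E//; try exact: measurable_itv.
transitivity (lebesgue_measure
    ([set` `[(size k)%:R * delta, (size k).+1%:R * delta[%R] : set R) *
  lebesgue_measure ([set` `[0, window_rate k]%R] : set R))%E; first by [].
rewrite !lebesgue_measure_itv /= !lte_fin.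
rewrite -natr1 mulrDl mul1r ltrDl.
have [d0|d0] := ltP 0 delta; last first.
  by rewrite (_ : delta = 0) ?mul0e ?mul0r//; apply/le_anti/andP.
have := window_rate_ge0 k; rewrite le_eqVlt => /orP[/eqP <-|->].
  by rewrite ltxx mule0 mulr0.
by rewrite -!EFinB -EFinM; congr EFin; ring.
Qed.

Lemma window_rect_disjoint k k' : size k != size k' ->
  window_rect k `&` window_rect k' = set0.
Proof.
wlog kk' : k k' / (size k < size k')%N => [H kk'|_].
  have := kk'; rewrite neq_ltn => /orP[lt|lt]; first exact: H.
  by rewrite setIC; apply: H; rewrite // eq_sym.
apply/seteqP; split=> // -[u v] [[/= + _] [/= + _]].
rewrite !in_itv /= => /andP[_ H1] /andP[H2 _].
have := le_lt_trans H2 H1.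
by apply/negP; rewrite -leNgt ler_wpM2r// ler_nat.
Qed.

Lemma window_rect_nat (dO : measure_display) (Omega : measurableType dO)
    (M : R.-ker Omega ~> (mR * mR)%type) : point_process window2 M ->
  forall om k, exists j : nat, M om (window_rect k) = j%:R%:E.
Proof.
move=> pp om k.
pose b := (size k).+1%:R * delta + window_rate k.
apply: (pp om (Num.Def.archi_bound b)); first exact: measurable_window_rect.
have b0 : 0 <= b by rewrite addr_ge0 ?window_rate_ge0// mulr_ge0.
have := archi_boundP b0 => bB.
move=> [u v] [] /=; rewrite !in_itv /= => /andP[u1 u2] /andP[v1 v2].
have u0 : 0 <= u by rewrite (le_trans _ u1)// mulr_ge0.
rewrite /window2 /= !ger0_norm//; split; apply: ltW; apply: le_lt_trans bB.
  by rewrite (le_trans (ltW u2))// lerDl window_rate_ge0.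
by rewrite (le_trans v2)// lerDr mulr_ge0.
Qed.

End windows.

Section pathwise.
Context {R : realType}.
Local Notation mR := (measurableTypeR R).
Variables (e th a delta t : R) (J : nat).
Hypotheses (th0 : 0 <= th) (a0 : 0 <= a) (delta0 : 0 < delta).
Hypothesis tJ : t <= J%:R * delta.
Variables (mu : {measure set (mR * mR) -> \bar R}) (n : {measure set mR -> \bar R}).
Variables (theta : 'rV[R]_3).
Hypothesis thetaE : [/\ base_rate theta = e, branching theta = th & decay theta = a].
Hypothesis nE : forall B : set mR, measurable B ->
  (n B = \int[mu]_(z in (B `&` [set s : R | (0 <= s)%R]) `*` setT)
     (\1_[set z : mR * mR | (0 <= z.2 <= lambda n z.1 theta)%R] z)%:E)%E.
Variables (L : seq mR) (w : R -> R).
Hypotheses (uL : uniq L) (Lt : forall s, s \in L -> 0 <= s < t).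
Hypothesis w0 : forall s, 0 <= w s.
Hypothesis nL : forall B : set mR, measurable B -> B `<=` `[0%R, t[ ->
  (n B = \sum_(s <- L) (w s)%:E * \d_s B)%E.
Hypothesis gap : forall s s', s \in L -> s' \in L -> s != s' -> delta < `|s - s'|.

Definition window_index (s : R) : nat := Num.trunc (s / delta).

Lemma window_indexP s : s \in L ->
  (window_index s)%:R * delta <= s < (window_index s).+1%:R * delta.
Proof.
move=> sL; have /andP[s0 _] := Lt sL.
rewrite -ler_pdivlMr// -ltr_pdivrMr//.
by apply: trunc_itv; rewrite divr_ge0// ltW.
Qed.

(** Two points of one window are at distance at most [delta], against [gap]. *)
Lemma window_index_inj : {in L &, injective window_index}.
Proof.
move=> s s' sL s'L ss'; apply/eqP; apply/negPn/negP => /(gap sL s'L).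
have := window_indexP sL; rewrite ss'; have := window_indexP s'L.
rewrite -natr1 mulrDl mul1r => /andP[H1 H2] /andP[H3 H4].
apply/negP; rewrite -leNgt ler_distl; apply/andP; split.
  by rewrite lerBlDr (le_trans (ltW H2))// lerD2r.
by rewrite (le_trans (ltW H4))// lerD2r.
Qed.

Lemma window_index_lt s : s \in L -> (window_index s < J)%N.
Proof.
move=> sL; have /andP[s1 _] := window_indexP sL; have /andP[_ st] := Lt sL.
have := le_lt_trans s1 (lt_le_trans st tJ).
by rewrite ltr_pM2r// ltr_nat.
Qed.

Lemma window_index_mono s s' : s \in L -> s' \in L -> s < s' ->
  (window_index s < window_index s')%N.
Proof.
move=> sL s'L ss'; rewrite ltn_neqAle; apply/andP; split.
  by apply: contraTneq ss' => /(window_index_inj sL s'L) ->; rewrite ltxx.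
rewrite -ltnS -(@ltr_nat R) -(@ltr_pM2r _ delta)//.
have /andP[s1 _] := window_indexP sL; have /andP[_ s2] := window_indexP s'L.
exact: le_lt_trans s1 (lt_trans ss' s2).
Qed.

Lemma atom_weight s : s \in L -> n [set s] = (w s)%:E.
Proof.
move=> sL; rewrite nL; [|exact: measurable_set1|by move=> x ->; rewrite /= in_itv/= Lt].
rewrite (big_rem s)//= diracE mem_set// mule1 big1_seq ?adde0// => r /andP[_].
rewrite mem_rem_uniq// => /andP[rs _].
by rewrite diracE memNset ?mule0// => /eqP; apply/negP.
Qed.

(** This is the thinning equation at a singleton: only the points of [mu] above [s] and below the
    intensity contribute. *)
Lemma atom_le_strip s : s \in L ->
  (n [set s] <= mu ([set s] `*` [set` `[0, lambda n s theta]%R]))%E.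
Proof.
move=> sL; rewrite nE; last exact: measurable_set1.
have mS : measurable ([set s] `*` [set` `[0, lambda n s theta]] : set (mR * mR)).
  by apply: measurableX; [exact: measurable_set1|exact: measurable_itv].
rewrite integral_mkcond -[X in (_ <= mu X)%E]setIT -integral_indic//.
apply: ge0_le_integral_nonmeasurable => z _.
  by rewrite /patch; case: ifP => _; rewrite ?lee_fin.
rewrite /patch; case: ifPn => [/set_mem[[/= zs _] _]|_]; last by rewrite lee_fin.
rewrite lee_fin !indicE ler_nat; case: z zs => u v /= ->.
have [vI|vI] := pselect (0 <= v <= lambda n s theta); last by rewrite memNset.
by rewrite [X in (_ <= nat_of_bool X)%N]mem_set ?leq_b1//; split; rewrite //= in_itv.
Qed.

Let rho : R := expR (- a * delta).

Lemma lambda_atomsE s : s \in L -> lambda n s theta =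
  e + th * \sum_(r <- L | r < s) w r * (a * expR (- a * (s - r))).
Proof.
move=> sL; have [be br dc] := thetaE; have /andP[s0 st] := Lt sL.
rewrite /lambda be br /Rintegral; congr (_ + _ * _).
have -> : (\int[n]_(x in `[0%R, s[) (exp_kernel (s - x) (decay theta))%:E =
    (\sum_(r <- [seq r <- L | r < s]) w r * exp_kernel (s - r) (decay theta))%:E)%E.
  apply: (@integral_finitely_supported _ mR R n [set` `[0%R, s[] mR _ w (@id mR)) => //.
  - apply: measurable_funTS; exact: measurable_exp_kernel.
  - move=> r; rewrite mem_filter => /andP[rs rL].
    by rewrite /= in_itv /= rs andbT; have /andP[] := Lt rL.
  - move=> B mB Bs; rewrite nL//; last first.
      move=> x /Bs /=; rewrite !in_itv /= => /andP[-> xs].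
      exact: lt_trans xs st.
    rewrite big_filter [in RHS]big_mkcond /=; apply: eq_bigr => r _.
    case: ifPn => // rs; rewrite diracE memNset ?mule0// => /Bs /=.
    by rewrite in_itv /= (negbTE rs) andbF.
by rewrite big_filter dc.
Qed.

Hypothesis mu_nat : forall k, exists j : nat, mu (window_rect e th a delta k) = j%:R%:E.

Let K := adaptive_counts (window_rect e th a delta) mu J.

Lemma count_window j : (j < J)%N ->
  mu (window_rect e th a delta (take j K)) = (nth 0%N K j)%:R%:E.
Proof.
move=> jJ; have sK : size K = J by rewrite size_adaptive_counts.
have : counts_cell (window_rect e th a delta) (fun _ : unit => mu) K tt.
  by rewrite /counts_cell /= sK.
rewrite counts_cell_bigcap// => cell.
have jK : (j < size K)%N by rewrite sK.
exact: (cell (Ordinal jK) I).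
Qed.

Lemma size_take_counts j : (j < J)%N -> size (take j K) = j.
Proof. by move=> jJ; rewrite size_takel// size_adaptive_counts ltnW. Qed.

(** It sits between the segment below the intensity at [s] and the rectangle of the window of [s];
    keeping the exact time [s] allows the mark at [s] to be read off later. *)
Definition strip s : set (mR * mR) :=
  [set s] `*` [set` `[0, window_rate e th a delta (take (window_index s) K)]].

Lemma measurable_strip s : measurable (strip s).
Proof. by apply: measurableX; [exact: measurable_set1|exact: measurable_itv]. Qed.

Lemma strip_sub s : s \in L ->
  strip s `<=` window_rect e th a delta (take (window_index s) K).
Proof.
move=> sL [u v] [/= -> vI]; split => //=.
rewrite size_take_counts ?window_index_lt// in_itv /=.
exact: window_indexP.
Qed.

(** Both bounds are proved together along the windows: the bounds on earlier weights put the
    intensity at [s] below [window_rate], hence the segment below it inside the strip, whose mass is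
    at most the count of the window. *)
Lemma atom_le_counts s : s \in L ->
  (n [set s] <= mu (strip s))%E /\ w s <= (nth 0%N K (window_index s))%:R.
Proof.
move=> sL; have [j sj] : exists j, window_index s = j by exists (window_index s).
(* The intensity at an event time only involves events of earlier windows. *)
elim/ltn_ind: j => j IH in s sL sj *.
have jJ : (j < J)%N by rewrite -sj window_index_lt.
suff : (n [set s] <= mu (strip s))%E.
  move=> H; split=> //; rewrite -lee_fin -atom_weight// (le_trans H)//.
  rewrite -count_window ?window_index_lt//.
  apply: le_measure; rewrite ?inE; [exact: measurable_strip| |exact: strip_sub].
  exact: measurable_window_rect.
apply: le_trans (atom_le_strip sL) _.
apply: le_measure; rewrite ?inE; [|exact: measurable_strip|].
  by apply: measurableX; [exact: measurable_set1|exact: measurable_itv].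
move=> [u v] [/= -> ]; rewrite in_itv /= => /andP[v0 vl]; split=> //=.
rewrite in_itv /= v0 (le_trans vl)// lambda_atomsE// /window_rate lerD2l -mulrA.
rewrite ler_wpM2l// discounted_sumE sj size_take_counts// -/rho.
rewrite -big_filter mulr_sumr.
have -> : \sum_(i < j) a * (rho ^+ (j.-1 - i) * (nth 0%N (take j K) i)%:R) =
   \sum_(i < j) a * (rho ^+ (j.-1 - i) * (nth 0%N K i)%:R).
  by apply: eq_bigr => i _; rewrite nth_take.
apply: (@sumr_le_inj R _ _ window_index j _
   (fun i => a * (rho ^+ (j.-1 - i) * (nth 0%N K i)%:R))).
- exact: filter_uniq.
- move=> r r'; rewrite !mem_filter => /andP[_ rL] /andP[_ r'L].
  exact: window_index_inj.
- by move=> r; rewrite mem_filter => /andP[rs rL]; rewrite -sj window_index_mono.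
- by move=> i; rewrite !mulr_ge0// exprn_ge0// expR_ge0.
move=> r; rewrite mem_filter => /andP[rs rL].
have rj : (window_index r < j)%N by rewrite -sj window_index_mono.
have [_ wr] := IH _ rj r rL erefl.
rewrite mulrCA ler_wpM2l// mulrC ler_pM ?expR_ge0//.
rewrite /rho -expRM_natl ler_expR !mulNr mulrN lerN2.
(* [r] precedes the right end of its window and [s] follows the left end of window [j], so they are
   at least [j - 1 - window_index r] windows apart; this is the exponent in the discounted sum. *)
have /andP[_ r2] := window_indexP rL; have /andP[s1 _] := window_indexP sL.
rewrite mulrCA ler_wpM2l//.
have -> : (j.-1 - window_index r)%:R = j%:R - (window_index r).+1%:R :> R.
  by rewrite -natrB//; case: (j) rj => // j'; rewrite ltnS => ?; rewrite subSS.
rewrite mulrBl -sj; exact: lerB (ltW r2).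
Qed.

(** Hoelder's inequality separates the total weight, dominated by the discounted counts, from the
    fourth powers of the marks, dominated by integrals over the Poisson rectangles. Discounting is
    measured from the end [J * delta] of the grid. *)
Lemma pathwise_power4_le (beta : R) (g : R -> R) : 0 <= beta ->
  (forall s, 0 <= g s) ->
  (((\sum_(s <- L) w s * expR (- beta * (J%:R * delta - s)) * g s) ^+ 4)%:E <=
   (discounted_sum (expR (- beta * delta)) K ^+ 3)%:E *
   \sum_(j < J) (expR (- beta * delta) ^+ (J.-1 - j))%:E *
     \int[mu]_(z in window_rect e th a delta (take j K)) (g z.1 ^+ 4)%:E)%E.
Proof.
move=> beta0 g0; pose b s := expR (- beta * (J%:R * delta - s)).
set r := expR (- beta * delta).
have b_ge0 s : 0 <= b s by exact: expR_ge0.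
have b_le s : s \in L -> b s <= r ^+ (J.-1 - window_index s).
  move=> sL; rewrite /b /r -expRM_natl ler_expR !mulNr mulrN lerN2.
  have /andP[_ s2] := window_indexP sL; have jJ := window_index_lt sL.
  rewrite mulrCA ler_wpM2l//.
  have -> : (J.-1 - window_index s)%:R = J%:R - (window_index s).+1%:R :> R.
    by rewrite -natrB//; case: (J) jJ => // j'; rewrite ltnS => ?; rewrite subSS.
  by rewrite mulrBl lerB// ltW.
have wb_ge0 s : 0 <= w s * b s by rewrite mulr_ge0.
have S_ge : \sum_(s <- L) w s * b s <= discounted_sum r K.
  rewrite discounted_sumE size_adaptive_counts.
  apply: (@sumr_le_inj R _ L window_index J _
    (fun j => r ^+ (J.-1 - j) * (nth 0%N K j)%:R)) => //.
  - exact: window_index_inj.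
  - exact: window_index_lt.
  - by move=> j; rewrite mulr_ge0 ?exprn_ge0 ?expR_ge0.
  - move=> s sL; rewrite mulrC ler_pM ?b_le//.
    by have [] := atom_le_counts sL.
apply: (@le_trans _ _ ((\sum_(s <- L) w s * b s) ^+ 3 *
    \sum_(s <- L) w s * b s * g s ^+ 4)%:E).
  by rewrite lee_fin sumr_power4_le.
have I0 j : (0 <= \int[mu]_(z in window_rect e th a delta (take j K))
    (g z.1 ^+ 4)%:E)%E.
  by apply: integral_ge0 => z _; rewrite lee_fin exprn_ge0.
rewrite EFinM; apply: lee_pmul.
- by rewrite lee_fin exprn_ge0// sumr_ge0.
- by rewrite lee_fin sumr_ge0// => s _; rewrite mulr_ge0// exprn_ge0.
- by rewrite lee_fin lerXn2r// nnegrE ?sumr_ge0// discounted_sum_ge0// expR_ge0.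
rewrite -sumEFin.
apply: (@ge0_sume_le_inj R _ L window_index J _ (fun j => (r ^+ (J.-1 - j))%:E *
  \int[mu]_(z in window_rect e th a delta (take j K)) (g z.1 ^+ 4)%:E)%E) => //.
- exact: window_index_inj.
- exact: window_index_lt.
- by move=> j; rewrite mule_ge0// lee_fin exprn_ge0// expR_ge0.
move=> s sL; rewrite [w s * b s]mulrC -mulrA EFinM.
apply: lee_pmul; [by rewrite lee_fin| |by rewrite lee_fin b_le|].
  by rewrite lee_fin mulr_ge0// exprn_ge0.
have [nstrip _] := atom_le_counts sL.
(* On the strip the integrand is constant, equal to its value at the event time [s]. *)
apply: (@le_trans _ _ (\int[mu]_(z in strip s) (g z.1 ^+ 4)%:E)%E).
  rewrite (eq_integral (cst (g s ^+ 4)%:E)); last first.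
    by move=> z /set_mem[/= -> _].
  rewrite integral_cst; last exact: measurable_strip.
  rewrite mulrC EFinM; apply: lee_wpmul2l; first by rewrite lee_fin exprn_ge0.
  by rewrite -atom_weight.
rewrite integral_mkcond [leRHS]integral_mkcond.
apply: ge0_le_integral_nonmeasurable => z _.
  by rewrite /patch; case: ifP => _; rewrite ?lee_fin ?exprn_ge0.
rewrite /patch; case: ifPn => [/set_mem zs|_].
  by rewrite mem_set//; exact: strip_sub zs.
by case: ifP => _; rewrite ?lee_fin ?exprn_ge0.
Qed.

End pathwise.

(** * Moment bound *)

Section thinned_moment.
Context {R : realType} {dO : measure_display} {Omega : measurableType dO}.
Variable P : probability Omega R.
Context {dY : measure_display} {Y : measurableType dY}.
Local Notation mR := (measurableTypeR R).
Variables (M : R.-ker Omega ~> (mR * mR)%type) (y : R -> Omega -> Y).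
Variables (phi : Y -> \bar R) (C : R).
Hypotheses (my : forall t, measurable_fun setT (y t)).
Hypothesis ind : independent_events P (path_events y) (measure_events M).
Hypothesis mphi : measurable_fun setT
  (fun z : (mR * g_sigma_algebraType (path_events y))%type => phi (y z.1 z.2)).
Hypothesis phi0 : forall t om, (0 <= phi (y t om))%E.
Hypothesis phiC : forall t, (\int[P]_om phi (y t om) = C%:E)%E.
Hypothesis MP : poisson_process P M.
Variables (e th a delta beta tau K L c : R) (J : nat).
Hypotheses (e0 : 0 <= e) (th0 : 0 <= th) (a0 : 0 <= a) (delta0 : 0 <= delta).

Let B := window_rect e th a delta.
Let r := expR (- beta * delta).

(* The bound on the fourth power of the marked sum given by Hoelder's
   inequality; it is a function of the marks and of the Poisson process. *)
Definition thinned_power4 (om : Omega) : \bar R :=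
  let k := adaptive_counts B (M om) J in
  ((discounted_sum r k ^+ 3)%:E *
   \sum_(j < J) (r ^+ (J.-1 - j))%:E *
     \int[M om]_(z in B (take j k)) phi (y z.1 om))%E.

(** The same quantity with the history frozen at [k], so that the domains of integration are no
    longer random; the two agree on the cell of [k]. *)
Let cell_power4 (k : seq nat) (om : Omega) : \bar R :=
  ((discounted_sum r k ^+ 3)%:E *
   \sum_(j < J) (r ^+ (J.-1 - j))%:E *
     \int[M om]_(z in B (take j k)) phi (y z.1 om))%E.

Let mB k : measurable (B k). Proof. exact: measurable_window_rect. Qed.

Let M_nat om k : exists j : nat, M om (B k) = j%:R%:E.
Proof. by case: MP => pp _ _; exact: window_rect_nat. Qed.

Let MB_fin om k : (M om (B k) < +oo)%E.
Proof. by have [j ->] := M_nat om k; rewrite ltry. Qed.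

Let r0 : 0 <= r. Proof. exact: expR_ge0. Qed.

Let mI k : measurable_fun setT (fun om => \int[M om]_(z in B k) phi (y z.1 om))%E.
Proof. exact: (measurable_integral_marks my mphi phi0 measurable_fst). Qed.

Let I0 k om : (0 <= \int[M om]_(z in B k) phi (y z.1 om))%E.
Proof. by apply: integral_ge0. Qed.

Let mterm k (j : nat) : measurable_fun setT (fun om => (r ^+ (J.-1 - j))%:E *
     \int[M om]_(z in B (take j k)) phi (y z.1 om))%E.
Proof. exact: measurable_funeM. Qed.

Let mcell_power4 k : measurable_fun setT (cell_power4 k).
Proof. by apply: measurable_funeM; apply: emeasurable_sum => j; exact: mterm. Qed.

Let cellE k om : size k = J -> counts_cell B M k om ->
  thinned_power4 om = cell_power4 k om.
Proof. by move=> sk; rewrite /counts_cell /= sk /thinned_power4 => ->. Qed.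

Lemma thinned_power4_ge0 om : (0 <= thinned_power4 om)%E.
Proof.
apply: mule_ge0; first by rewrite lee_fin exprn_ge0// discounted_sum_ge0.
by apply: sume_ge0 => j _; rewrite mule_ge0// lee_fin exprn_ge0.
Qed.

(** Countably many cells, one per history of length [J], cover [Omega]; the [pickle] codes enumerate
    them. *)
Lemma measurable_thinned_power4 : measurable_fun setT thinned_power4.
Proof.
pose E p := if (unpickle p : option (seq nat)) is Some k then
  (if size k == J then counts_cell B M k else set0) else set0.
have -> : setT = \bigcup_p E p.
  apply/seteqP; split=> // om _; exists (pickle (adaptive_counts B (M om) J)) => //.
  by rewrite /E pickleK size_adaptive_counts eqxx /counts_cell /= size_adaptive_counts.
have mE p : measurable (E p).
  rewrite /E; case: unpickle => [k|]; last exact: measurable0.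
  by case: ifP => _; [exact: measurable_counts_cell|exact: measurable0].
apply/(measurable_fun_bigcup _ mE) => p; rewrite /E.
case: unpickle => [k|]; last exact: measurable_fun_set0.
case: ifP => [/eqP sk|_]; last exact: measurable_fun_set0.
apply: (eq_measurable_fun (cell_power4 k)).
  by move=> om /set_mem ck; rewrite (cellE sk).
exact: measurable_funTS.
Qed.

(** On the cell the counts are constants and independence turns each mark into its mean [C]. The
    remaining sum is the discounted sum once more, raising the cube to a fourth power. *)
Lemma integral_cell_thinned_power4 k : size k = J ->
  (\int[P]_(om in counts_cell B M k) thinned_power4 om =
   (C * discounted_sum r k ^+ 4)%:E * P (counts_cell B M k))%E.
Proof.
move=> sk; have mA := measurable_counts_cell k mB M_nat.
have eA : measure_events M (counts_cell B M k).
  (* Measurability over the coarse kernel says that the cell is an event of [M] itself. *)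
  exact: (@measurable_counts_cell _ _ R B _ _ (coarse_kernel M) k mB M_nat).
have cell_count j om : (j < J)%N -> counts_cell B M k om ->
    M om (B (take j k)) = (nth 0%N k j)%:R%:E.
  move=> jJ; rewrite counts_cell_bigcap// => ck.
  have jk : (j < size k)%N by rewrite sk.
  exact: (ck (Ordinal jk) I).
rewrite (eq_integral (cell_power4 k)); last first.
  by move=> om /set_mem ck; rewrite (cellE sk).
rewrite ge0_integralZl//; last 3 first.
- by apply: measurable_funTS; apply: emeasurable_sum => j; exact: mterm.
- by move=> om _; apply: sume_ge0 => j _; rewrite mule_ge0// lee_fin exprn_ge0.
- by rewrite lee_fin exprn_ge0// discounted_sum_ge0.
rewrite ge0_integral_sum//; last 2 first.
- by move=> j; apply: measurable_funTS; exact: mterm.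
- by move=> j om _; rewrite mule_ge0// lee_fin exprn_ge0.
rewrite (eq_bigr (fun j : 'I_J => ((r ^+ (J.-1 - j) * (nth 0%N k j)%:R)%:E *
    (C%:E * P (counts_cell B M k)))%E)); last first.
  move=> j _; rewrite ge0_integralZl//; last 2 first.
  - exact: measurable_funTS.
  - by rewrite lee_fin exprn_ge0.
  rewrite (integral_independent_marks my ind mphi phi0 phiC)//.
  rewrite (eq_integral (cst (nth 0%N k j)%:R%:E)); last first.
    by move=> om /set_mem ck; exact: cell_count.
  by rewrite integral_cst// EFinM -!muleA; congr (_ * _)%E; rewrite muleCA.
rewrite -ge0_sume_distrl; last first.
  by move=> j _; rewrite lee_fin mulr_ge0// exprn_ge0.
rewrite sumEFin !muleA -!EFinM; congr (_%:E * _)%E.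
by rewrite -sk -discounted_sumE exprSr; ring.
Qed.

Hypotheses (tau0 : 0 <= tau) (K0 : 0 <= K) (L0 : 0 <= L) (c0 : 0 < c).
Hypothesis (beta0 : 0 <= beta).
Hypothesis exp_le : forall y, 0 <= y <= c * (1 + K) -> expR y - 1 <= (1 + tau) * y.
Hypothesis stab : delta * (th * a) * (1 + tau) * (1 + K) <=
  K * (expR (- beta * delta) - expR (- a * delta)).
Hypothesis base : delta * e * (1 + tau) * (1 + K) <= L * (1 - expR (- beta * delta)).

Lemma integral_thinned_power4_le :
  (\int[P]_om thinned_power4 om <= (C * (24 / c ^+ 4) * expR (L * c))%:E)%E.
Proof.
have C0 : 0 <= C.
  by rewrite -lee_fin -(phiC 0); apply: integral_ge0.
(* [D] collects the moment of the marks and the cost of replacing a fourth power by an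
   exponential. *)
pose D := C * (24 / c ^+ 4).
have D0 : 0 <= D by rewrite mulr_ge0// divr_ge0// exprn_ge0// ltW.
have r1 : r <= 1 by rewrite -expR0 ler_expR mulNr oppr_le0 mulr_ge0.
pose rho := expR (- a * delta).
pose Phi k := D * lyapunov r rho K L c J k.
(* For the empty history both sums vanish and the exponent is at most [L * c], whatever [J] and
   [delta] are. *)
apply: (@le_trans _ _ (Phi [::])%:E); last first.
  rewrite lee_fin ler_wpM2l// ler_expR /discounted_sum /= !mulr0 addr0 mulr0 add0r.
  by rewrite ler_wpM2l// gerBl mulr_ge0 ?(ltW c0)// exprn_ge0.
apply: (@ge0_integral_cells_le _ _ _ _ _ P M B
  (fun k => poisson_weight (delta * window_rate e th a delta k)) J) => //.
- move=> k m; apply: (@poisson_counts_cell _ _ _ P M B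
    (fun k => delta * window_rate e th a delta k)) => //.
  + by move=> k'; exact: lebesgue2_window_rect.
  + by move=> k1 k2; exact: window_rect_disjoint.
- exact: measurable_thinned_power4.
- exact: thinned_power4_ge0.
- by move=> k m; rewrite poisson_weight_ge0// mulr_ge0// window_rate_ge0.
- by move=> k; rewrite mulr_ge0// expR_ge0.
- move=> k sk; rewrite integral_cell_thinned_power4//.
  apply: lee_wpmul2r => //; rewrite lee_fin /Phi /D -!mulrA ler_wpM2l//.
  have s0 : 0 <= discounted_sum r k by exact: discounted_sum_ge0.
  rewrite (le_trans (exp4_le c0 s0))// -mulrA !ler_wpM2l//.
    by rewrite invr_ge0 exprn_ge0// ltW.
  (* At full length the coefficient is [c] and the term in [L] vanishes. *)
  rewrite /lyapunov sk subnn expr0 mulr1 subrr mulr0 addr0 ler_expR.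
  by rewrite ler_wpM2l ?(ltW c0)// lerDl mulr_ge0// discounted_sum_ge0// expR_ge0.
- move=> k kJ; apply: (@lyapunov_step R e (th * a) delta tau) => //.
  + exact: mulr_ge0.
  + by rewrite r0.
  + exact: ltW.
Qed.

End thinned_moment.

(** * Passage to the limit of fine meshes *)

Lemma limn_einf_sup_einfs (R : realType) (u : (\bar R)^nat) :
  limn_einf u = ereal_sup (range (einfs u)).
Proof. by rewrite limn_einf_lim; apply/cvg_lim => //; exact: cvg_einfs_sup. Qed.

Lemma ge0_integral_eventually_le d (T : measurableType d) (R : realType)
    (mu : {measure set T -> \bar R}) (f : T -> \bar R) (F : (T -> \bar R)^nat)
    (b : \bar R) :
  (forall n, measurable_fun setT (F n)) -> (forall n x, 0 <= F n x)%E ->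
  (forall x, 0 <= f x)%E -> (forall n, \int[mu]_x F n x <= b)%E ->
  {ae mu, forall x, exists n0, forall n, (n0 <= n)%N -> (f x <= F n x)%E} ->
  (\int[mu]_x f x <= b)%E.
Proof.
move=> mF F0 f0 Fb [N [mN N0 fN]].
pose l x := limn_einf (F ^~ x).
have ml : measurable_fun setT l.
  apply: (emeasurable_fun_cvg (fun n x => einfs (F ^~ x) n)).
    by move=> n; exact: measurable_fun_einfs.
  by move=> x _; rewrite /l limn_einf_lim; exact: is_cvg_einfs.
have l0 x : (0 <= l x)%E.
  rewrite /l limn_einf_sup_einfs; apply: le_trans (ereal_sup_ubound _).
    2: by exists 0%N.
  by apply/ereal_infP => _ [n _ <-].
(* [f] may fail to be measurable, so it is not modified on the null set; its upper bound is raised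
   to infinity there instead. *)
pose g x := if x \in N then +oo%E else l x.
have mg : measurable_fun setT g.
  apply: measurable_fun_ifT => //.
  by apply: (measurable_fun_bool true); rewrite setTI (_ : _ @^-1` _ = N)//;
    apply/seteqP; split=> x /=; [move/set_mem|move/mem_set].
have g0 x : (0 <= g x)%E by rewrite /g; case: ifP.
apply: (@le_trans _ _ (\int[mu]_x g x)%E).
  apply: ge0_le_integral_nonmeasurable => x _; first exact: f0.
  rewrite /g; case: ifPn => [_|xN]; first by rewrite leey.
  have [n0 fF] : exists n0, forall n, (n0 <= n)%N -> (f x <= F n x)%E.
    by apply: contrapT => H; move/negP: xN; apply; rewrite inE; exact: fN.
  rewrite /l limn_einf_sup_einfs; apply: le_trans (ereal_sup_ubound _).
    2: by exists n0.
  by apply/ereal_infP => _ [n n0n <-]; exact: fF.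
apply: (@le_trans _ _ (\int[mu]_x l x)%E).
  rewrite le_eqVlt; apply/orP; left; apply/eqP; apply: ge0_ae_eq_integral => //.
  exists N; split => // x /= H; apply: contrapT => xN; apply: H => _.
  by rewrite /g memNset.
apply: le_trans (fatou mu measurableT mF (fun n x _ => F0 n x)) _.
rewrite limn_einf_sup_einfs; apply: ge_ereal_sup => _ [n _ <-].
apply: le_trans (Fb n); apply: ereal_inf_lbound; exists n => //=.
Qed.

Lemma Lnorm4_le d (T : measurableType d) (R : realType)
    (mu : {measure set T -> \bar R}) (f : T -> \bar R) (F : (T -> \bar R)^nat)
    (z : T -> R) (C b : R) :
  0 <= C -> (forall n, measurable_fun setT (F n)) -> (forall n x, 0 <= F n x)%E ->
  (forall x, 0 <= f x <= (C * z x)%:E)%E ->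
  (forall n, \int[mu]_x F n x <= b%:E)%E ->
  {ae mu, forall x, exists n0, forall n, (n0 <= n)%N ->
    ((z x ^+ 4)%:E <= F n x)%E} ->
  (Lnorm mu 4%:R%:E f <= ((C ^+ 4 * b) `^ 4^-1)%:E)%E.
Proof.
move=> C0 mF F0 fz Fb zF; rewrite unlock -poweR_EFin.
have fp x : (`|f x| `^ 4%:R <= (C ^+ 4 * z x ^+ 4)%:E)%E.
  have /andP[f0 fzx] := fz x.
  have Cz0 : 0 <= C * z x by rewrite -lee_fin (le_trans f0).
  rewrite -exprMn -powR_mulrn// -poweR_EFin gee0_abs//.
  by apply: gt0_ler_poweR => //; rewrite in_itv /= ?leey ?andbT// lee_fin.
have int_le : (\int[mu]_x `|f x| `^ 4%:R <= (C ^+ 4 * b)%:E)%E.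
  apply: (@ge0_integral_eventually_le _ _ _ _ _ (fun n x => (C ^+ 4)%:E * F n x)%E).
  - by move=> n; exact: measurable_funeM.
  - by move=> n x; rewrite mule_ge0// lee_fin exprn_ge0.
  - by move=> x; exact: poweR_ge0.
  - move=> n; rewrite ge0_integralZl//; last by rewrite lee_fin exprn_ge0.
    by rewrite (EFinM (C ^+ 4) b); apply: lee_wpmul2l => //; rewrite lee_fin exprn_ge0.
  - apply: filterS zF => x [n0 H]; exists n0 => n n0n.
    apply: (le_trans (fp x)); rewrite (EFinM (C ^+ 4)).
    by apply: lee_wpmul2l; [rewrite lee_fin exprn_ge0|exact: H].
have i0 : (0 <= \int[mu]_x `|f x| `^ 4%:R)%E.
  by apply: integral_ge0 => x _; exact: poweR_ge0.
apply: gt0_ler_poweR => //; rewrite in_itv /= leey andbT//.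
exact: le_trans int_le.
Qed.

(** Finitely many distinct points have a positive least gap. *)
Lemma eventually_mesh_lt_gaps (R : realType) (I : eqType) (L : seq I)
    (x : I -> R) (T : R) : 0 < T -> {in L &, injective x} ->
  exists n0, forall n, (n0 <= n)%N -> forall s s', s \in L -> s' \in L ->
    s != s' -> T / n.+1%:R < `|x s - x s'|.
Proof.
move=> T0 xI.
(* Diagonal pairs divide by zero, which gives 0 and does no harm in a maximum. *)
exists (\max_(s <- L) \max_(s' <- L) Num.Def.archi_bound (T / `|x s - x s'|)%R).
move=> n Ln s s' sL s'L ss'.
have gap0 : 0 < `|x s - x s'|.
  by rewrite normr_gt0 subr_eq0; apply: contra_neq ss'; exact: xI.
rewrite ltr_pdivrMr// mulrC -ltr_pdivrMr//.
apply: lt_le_trans (archi_boundP _) _; first by rewrite divr_ge0// ltW.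
rewrite ler_nat; apply: leq_trans (leqW Ln).
apply: leq_trans (@leq_bigmax_seq _ L xpredT
  (fun s => \max_(s' <- L) Num.Def.archi_bound (T / `|x s - x s'|)%R) s sL isT).
exact: (@leq_bigmax_seq _ L xpredT
  (fun s' => Num.Def.archi_bound (T / `|x s - x s'|)%R) s' s'L isT).
Qed.

(** Points and weights are packed in one pair so that a single choice function of the outcome can
    select them. *)
Lemma point_process_atoms (R : realType) (dO : measure_display)
    (Omega : measurableType dO) (N : R.-ker Omega ~> measurableTypeR R)
    (om : Omega) (t : R) : point_process (@window1 R) N ->
  exists Lw : seq (measurableTypeR R) * (R -> R),
    [/\ uniq Lw.1, forall s, s \in Lw.1 -> 0 <= s < t, forall s, 0 <= Lw.2 s &
      forall B : set (measurableTypeR R), measurable B -> B `<=` `[0%R, t[ ->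
        (N om B = \sum_(s <- Lw.1) (Lw.2 s)%:E * \d_s B)%E].
Proof.
move=> pp; pose D : set (measurableTypeR R) := [set` `[0, t[].
have mD : measurable D by exact: measurable_itv.
have Nnat B : measurable B -> B `<=` D -> exists k : nat, N om B = k%:R%:E.
  move=> mB BD; apply: (pp om (Num.Def.archi_bound t) B mB) => s /BD.
  rewrite /D /window1 /= in_itv /= => /andP[s0 st].
  rewrite ger0_norm// ltW// (lt_trans st)// archi_boundP//.
  by rewrite (le_trans s0)// ltW.
have [L [uL LD NE]] := integer_measure_atoms mD Nnat.
exists (L, fun s => fine (N om [set s])); split=> //=.
move=> B mB BD; rewrite NE// big_seq [RHS]big_seq; apply: eq_bigr => s sL.
congr (_ * _)%E; have [|k ->] // := Nnat [set s] (measurable_set1 s).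
by move=> x ->; exact: LD.
Qed.

(** * Assembly of the estimates *)

Unset Implicit Arguments.
Set Strict Implicit.
Set Printing Implicit Defensive.

Theorem lemma1 (R : realType) (dO : measure_display)
  (Omega : measurableType dO) (P : probability Omega R)
  (d q r : nat)
  (X : set (d.-tuple (measurableTypeR R)))
  (Phi : set 'rV[R]_q) (phistar : 'rV[R]_q)
  (f : d.-tuple (measurableTypeR R) -> 'rV[R]_q -> R)
  (y : R -> Omega -> d.-tuple (measurableTypeR R))
  (Psi : set 'rV[R]_r) (h : d.-tuple (measurableTypeR R) -> 'rV[R]_r -> R)
  (Theta : set 'rV[R]_3) (thetastar : 'rV[R]_3)
  (eta_lo eta_hi vartheta_lo vartheta_hi alpha_lo alpha_hi : R)
  (Nbar : R.-ker Omega ~> (measurableTypeR R * measurableTypeR R)%type)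
  (N : R.-ker Omega ~> measurableTypeR R)
  (Ng : R.-ker Omega ~>
        (measurableTypeR R * d.-tuple (measurableTypeR R))%type) :
  measurable X -> Phi phistar -> density_family X f Phi ->
  mark_process X f P y phistar ->
  poisson_process P Nbar ->
  independent_events P (path_events y) (measure_events Nbar) ->
  Psi 0 -> boost_conditions X f h Phi Psi phistar ->
  open Theta -> compact (closure Theta) ->
  0 < eta_lo -> 0 < vartheta_lo -> 0 < alpha_lo ->
  (forall theta, Theta theta ->
     [/\ eta_lo <= base_rate theta <= eta_hi,
         vartheta_lo <= branching theta <= vartheta_hi &
         alpha_lo <= decay theta <= alpha_hi]) ->
  Theta thetastar -> branching thetastar < 1 ->
  hawkes_process P Nbar N thetastar ->
  marked_measure N y Ng ->
  has_expect X f phistar (fun x => `|scoreG X f h phistar x| ^+ 4) ->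
  (ereal_sup
     [set \sum_(i < 3)
        Lnorm P (maxn (3 + 1) 4)%:R%:E
          (fun omega => ereal_sup
             [set (norm_partials i
                     (fun theta' =>
                        dpsi_lambda_g X f h (Ng omega) t theta' phistar 0)
                     theta)%:E | theta in Theta])
     | t in [set t : R | (0 <= t)%R]] < +oo)%E.

Proof.
move=> mX Phistar fd mp PN ind Psi0 bc _ _ eta_lo0 vth_lo0 al_lo0 box Tstar vth1
  [Npp hawkes] marked G4.
set e := base_rate thetastar; set th := branching thetastar in vth1 *.
set a := decay thetastar.
have [/andP[e_lo _] /andP[th_lo th_hi] /andP[a_lo a_hi]] := box _ Tstar.
have e0 : 0 < e by exact: lt_le_trans e_lo.
have th0 : 0 < th by exact: lt_le_trans th_lo.
have a0 : 0 < a by exact: lt_le_trans a_lo.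
(* Half of the minimum meets both demands: [beta < alpha_lo] dominates the kernel derivatives, and
   [beta <= a * (1 - th) / 2] gives stability. *)
pose beta := Num.min alpha_lo (a * (1 - th)) / 2.
have m0 : 0 < Num.min alpha_lo (a * (1 - th)).
  by rewrite lt_min al_lo0 mulr_gt0// subr_gt0.
have beta0 : 0 < beta by rewrite divr_gt0.
have beta_al : beta < alpha_lo.
  have : Num.min alpha_lo (a * (1 - th)) <= alpha_lo by rewrite ge_min lexx.
  by rewrite /beta; lra.
have beta_a : beta <= a * (1 - th) / 2.
  by rewrite /beta ler_wpM2r// ge_min lexx orbT.
have [[my mjoint] _ _ yX _] := mp.
pose g (x : d.-tuple (measurableTypeR R)) : R := `|scoreG X f h phistar x|.
have g0 x : 0 <= g x by exact: normr_ge0.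
pose phi x : \bar R := (g x ^+ 4)%:E.
have [m4 m40 m4E] := score_moment mX Phistar Psi0 fd bc mp G4.
have mphi : measurable_fun setT (fun z : (measurableTypeR R *
    g_sigma_algebraType (path_events y))%type => phi (y z.1 z.2)).
  apply: (@measurable_comp _ _ _ _ _ _ X phi) => //.
  - by move=> _ [z _ <-]; exact: yX.
  - apply/measurable_EFinP; apply: measurable_funX.
    exact: measurable_scoreG_norm mX Psi0 bc.
have mys om : measurable_fun setT (fun s : measurableTypeR R => y s om).
  apply: (measurableT_comp mjoint (measurable_fun_pair _ _)) => //.
have vth_hi0 : 0 <= vartheta_hi by rewrite (le_trans (ltW th0)).
have al_hi0 : 0 <= alpha_hi by rewrite (le_trans (ltW a0)).
have [C C0 CP] := norm_partials_kernel_sum_le vth_hi0 al_hi0 beta_al.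
have th01 : 0 < th < 1 by rewrite th0.
have bb : 0 < beta <= a * (1 - th) / 2 by rewrite beta0.
have [delta0 [tau [K [L [c [[d0 tau0 K0 L0 c0] [exp_le stab]]]]]]] :=
  stability_constants (ltW e0) th01 a0 bb.
pose b := m4 * (24 / c ^+ 4) * expR (L * c).
(* The factor [expR beta] pays for discounting from [t + 1] instead of [t]. *)
pose K1 := (((C * expR beta) ^+ 4 * b) `^ 4^-1)%R.
apply: (@le_lt_trans _ _ (\sum_(i < 3) K1%:E)%E); last by rewrite sumEFin ltry.
apply: ge_ereal_sup => _ [t t0 <-]; apply: lee_sum => i _.
rewrite (_ : maxn (3 + 1) 4 = 4%N)//.
have [Lw LwP] := choice (fun om => point_process_atoms om t Npp).
(* The extra unit of time keeps the mesh positive even at [t = 0]. *)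
pose T := t + 1; have T0 : 0 < T by rewrite /T ltr_wpDl.
pose z om := \sum_(s <- (Lw om).1) (Lw om).2 s * expR (- beta * (T - s)) * g (y s om).
pose n0 := Num.Def.archi_bound (T / delta0).
(* The offset [n0] keeps every mesh below [delta0]. *)
pose J n := (n + n0).+1; pose delta n := T / (J n)%:R.
have delta_gt0 n : 0 < delta n by rewrite divr_gt0.
have JdeltaE n : (J n)%:R * delta n = T by rewrite mulrCA divff ?mulr1 // pnatr_eq0.
have delta_le n : delta n <= delta0.
  rewrite ler_pdivrMr// mulrC -ler_pdivrMr// ltW//.
  apply: lt_le_trans (archi_boundP _) _; first by rewrite divr_ge0// ltW.
  by rewrite ler_nat /J -/n0 leqW// leq_addl.
pose F n := thinned_power4 Nbar y phi e th a (delta n) beta (J n).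
apply: (@Lnorm4_le _ _ _ _ _ F z) => //.
- by rewrite mulr_ge0// expR_ge0.
- move=> n; apply: (measurable_thinned_power4 my mphi _ PN); try exact: ltW.
  by move=> s om; rewrite lee_fin exprn_ge0.
- by move=> n om; apply: thinned_power4_ge0 => s om'; rewrite lee_fin exprn_ge0.
- move=> om; have [uL Lt w0 NE] := LwP om.
  set w := (Lw om).2 in w0 NE *; set LL := (Lw om).1 in uL Lt NE *.
  have dpsiE theta : dpsi_lambda_g X f h (Ng om) t theta phistar 0 =
      \sum_(s <- LL) kernel_partial 0 0 0 (t - s) theta *:
        (w s *: scoreG X f h phistar (y s om)).
    apply: (dpsi_lambda_gE theta mX bc (mys om)) => //; last exact: NE.
    by move=> A mA; exact: marked.
  rewrite (funext dpsiE).
  apply/andP; split.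
    (* The supremum is nonnegative because [Theta] contains [thetastar]. *)
    apply: le_trans (ereal_sup_ubound _); last by exists thetastar.
    by rewrite lee_fin /norm_partials; apply: bigmax_ge_id.
  apply: ge_ereal_sup => _ [theta Ttheta <-]; rewrite lee_fin.
  have [_ /andP[b1 b2] /andP[a1 a2]] := box _ Ttheta.
  apply: le_trans (CP _ _ LL (fun s => t - s) _ i theta _ _ _ _ _) _ => //.
  + by rewrite -ltnS ltn_ord.
  + by move=> s /Lt /andP[_ st]; rewrite subr_ge0 ltW.
  + by rewrite b2 (le_trans (ltW vth_lo0) b1).
  + by rewrite a1 ltW.
  rewrite -mulrA ler_wpM2l// /z mulr_sumr ler_sum// => s _.
  rewrite normrZ ger0_norm// -/(g _).
  rewrite (_ : expR (- beta * (t - s)) = expR beta * expR (- beta * (T - s))).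
    by rewrite le_eqVlt; apply/orP; left; apply/eqP; rewrite /w; ring.
  by rewrite -expRD; congr expR; rewrite /T; ring.
- move=> n; have dn : 0 <= delta n <= delta0 by rewrite ltW ?delta_le.
  have [stab1 stab2] := stab _ dn.
  apply: (@integral_thinned_power4_le _ _ _ P _ _ Nbar y phi m4 my ind mphi _ _ PN
    e th a (delta n) beta tau K L c (J n)) => //; try exact: ltW.
  by move=> s om; rewrite lee_fin exprn_ge0.
(* Almost surely the thinning equation holds; once the mesh is below the gaps of the path, the
   pathwise domination applies. *)
apply: filterS hawkes => om nE; have [uL Lt w0 NE] := LwP om.
have [n1 gapP] := @eventually_mesh_lt_gaps R _ (Lw om).1 id T T0 (fun s s' _ _ => id).
exists n1 => n n1n.
have tJ : t <= (J n)%:R * delta n by rewrite JdeltaE lerDl.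
have gap s s' : s \in (Lw om).1 -> s' \in (Lw om).1 -> s != s' ->
    delta n < `|s - s'|.
  by apply: gapP; rewrite (leq_trans n1n)// leq_addr.
have Nbar_nat k : exists j : nat, Nbar om (window_rect e th a (delta n) k) = j%:R%:E.
  by case: PN => pp _ _; apply: window_rect_nat => //; exact: ltW.
have := pathwise_power4_le (ltW th0) (ltW a0) (delta_gt0 n) tJ
  (And3 erefl erefl erefl) nE uL Lt w0 NE gap Nbar_nat (ltW beta0)
  (fun s => g0 (y s om)).
by rewrite JdeltaE.
Qed.
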